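(* Let $(W,S)$ be a Coxeter system with $S$ finite and Coxeter matrix $(m_{st})_{s,t\in S}$. A heap $H$ is the heap of some word $\mathbf{w}$ corresponding to a cyclically fully commutative (CFC) element $w\in W$ if and only if both of the following conditions are satisfied: (1) there is no cylindric convex chain $i_1\prec_c\cdots\prec_c i_{m_{st}}$ in the cylindric transformation $H^c$ such that $s_{a_{i_1}}=s_{a_{i_3}}=\cdots=s$ and $s_{a_{i_2}}=s_{a_{i_4}}=\cdots=t$, where $3\le m_{st}<\infty$; (2) there is no chain covering relation $i\prec_c j$ in the cylindric transformation $H^c$ such that $s_{a_i}=s_{a_j}$.
   Context: A word (expression) is a finite sequence of elements of $S$; $\ell(w)$ is the minimal length of an expression of $w$, and expressions of that length are reduced. An element $w\in W$ is fully commutative (FC) if any reduced expression of $w$ can be obtained from any other by transpositions of adjacent commuting generators. A cyclic shift of $s_{i_1}\cdots s_{i_n}$ is any word $s_{i_k}\cdots s_{i_n}s_{i_1}\cdots s_{i_{k-1}}$. An element $w\in W$ is cyclically fully commutative (CFC) if every cyclic shift of every reduced expression of $w$ is a reduced expression of an FC element. Heap: for a word $\mathbf{w}=s_{a_1}\cdots s_{a_\ell}$, the heap $H=H_{\mathbf{w}}$ is the set of indices (points) $\{1,\dots,\ell\}$ with the labelling $i\mapsto s_{a_i}$ and the partial order $\prec$ obtained as the transitive closure of the relations $i\prec j$ whenever $i<j$ and either $s_{a_i}=s_{a_j}$ or $m_{s_{a_i}s_{a_j}}\ge 3$. Heaps are considered up to label-preserving poset isomorphism. For $I\subset S$, $H_I$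 is the subposet of points with label in $I$; $H_s:=H_{\{s\}}$, which is a chain. If $m_{st}\geq 3$, $H_{\{s,t\}}$ is a chain. Chain covering relation in $H$: $i\prec_c j$ means $i\prec j$ and either ($m_{s_{a_i}s_{a_j}}\ge 3$ and there is no point $z$ with the same label as $i$ or $j$ such that $i\prec z\prec j$), or ($s_{a_i}=s_{a_j}$ and there is no point $z$ with $i\prec z\prec j$). Cylindric transformation: $H^c$ is the labelled set of points of $H$ with the binary relation $\prec_c$ (whose instances are called the chain covering relations of $H^c$) made of the chain covering relations of $H$ together with the following new relations: (i) for each generator $s$, let $a$ be the minimal and $b$ the maximal point of the chain $H_s$; if $a$ is minimal in $H$ and $b$ is maximal in $H$, add $b\prec_c a$; (ii) for each pair of generators $s,t$ with $m_{st}\ge 3$, let $a$ be the minimal and $b$ the maximal point of the chain $H_{\{s,t\}}$; if $a$ and $b$ have different labels, add $b\prec_c a$. Cylindric convex chain: let $s,t$ be generators with $m_{st}\ge 3$ and let $i_1\prec_c\cdots\prec_c i_m$ be a chain in $H^c$ with $m\ge 3$, all $i_k$ distinct, and labels $s_{a_{i_1}}=s_{a_{i_3}}=\cdots=s$, $s_{a_{i_2}}=s_{a_{i_4}}=\cdots=t$. It is cylindric convex if the only elements $u_1,\dots,u_d$ satisfying $i_1\prec_c\cdots\prec_c i_k\prec_c u_1\prec_c\cdots\prec_c u_d\prec_c i_m$, with all elements involved in this second chain distinct, are the elements $i_j$ of the first chain.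
   Formalization: Condition (2) is required only for distinct points i ≠ j, since rule (i) adds a loop at an isolated point with a unique label (e.g. the one-letter word s, which is CFC); the word w is taken to be a reduced expression of the CFC element (sss would violate (2)). *)

(* Defs.v *)
From HB Require Import structures.
From mathcomp Require Import all_boot.

Set Implicit Arguments.
Unset Strict Implicit.
Unset Printing Implicit Defensive.

Import Algebra.

Local Open Scope group_scope.

(* The entry m_st = oo is encoded by m s t = 0; note that x ^+ 0 = 1, so that
   the corresponding relation is void, and that 3 <= m s t means
   3 <= m_st < oo. *)
Definition coxeter_matrix (S : finType) (m : S -> S -> nat) : Prop :=
  [/\ forall s, m s s = 1%N,
      forall s t, m s t = m t s &
      forall s t, s != t -> m s t != 1%N].

Definition coxeter_relations (S : finType) (m : S -> S -> nat)
    (G : groupType) (f : S -> G) : Prop :=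
  forall s t, (f s * f t) ^+ m s t = 1.

(* W is the group presented by the generators S and the relations
   (st)^(m_st) = 1, expressed by its universal property. *)
Definition coxeter_system (S : finType) (m : S -> S -> nat)
    (W : groupType) (gen : S -> W) : Prop :=
  [/\ coxeter_matrix m,
      coxeter_relations m gen &
      forall (G : groupType) (f : S -> G), coxeter_relations m f ->
        (exists phi : {multiplicative W -> G}, forall s, phi (gen s) = f s)
        /\ (forall phi psi : {multiplicative W -> G},
              (forall s, phi (gen s) = f s) -> (forall s, psi (gen s) = f s) ->
              phi =1 psi)].

Section Words.
Variables (S : finType) (W : groupType) (gen : S -> W).

Definition word_eval (w : seq S) : W := \big[*%g/1]_(s <- w) gen s.

Definition expression_of (x : W) (w : seq S) : Prop := word_eval w = x.

Definition reduced (w : seq S) : Prop :=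
  forall v, word_eval v = word_eval w -> size w <= size v.

Definition reduced_expression_of (x : W) (w : seq S) : Prop :=
  expression_of x w /\ reduced w.

Inductive commutation_equiv : seq S -> seq S -> Prop :=
| CommRefl w : commutation_equiv w w
| CommStep a b s t w : commute (gen s) (gen t) ->
    commutation_equiv (a ++ t :: s :: b) w ->
    commutation_equiv (a ++ s :: t :: b) w.

Definition fully_commutative (x : W) : Prop :=
  forall u v, reduced_expression_of x u -> reduced_expression_of x v ->
    commutation_equiv u v.

Definition cyclically_fully_commutative (x : W) : Prop :=
  forall w, reduced_expression_of x w -> forall k,
    exists y, fully_commutative y /\ reduced_expression_of y (rot k w).

End Words.

(* A finite set of points with a labelling and a (strict) order relation. *)
Record labelled_poset (S : finType) := LabelledPoset {
  point :> finType;
  label : point -> S;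
  prec : rel point }.

Section Heaps.
Variables (S : finType) (m : S -> S -> nat).

(* m_st >= 3, the value oo (encoded by 0) included *)
Definition m_ge3 (s t : S) : bool := (m s t == 0) || (3 <= m s t).

Definition heap_edge (w : seq S) : rel 'I_(size w) :=
  fun i j => (i < j) && ((tnth (in_tuple w) i == tnth (in_tuple w) j)
                         || m_ge3 (tnth (in_tuple w) i) (tnth (in_tuple w) j)).

(* connect is the reflexive transitive closure *)
Definition heap (w : seq S) : labelled_poset S :=
  LabelledPoset (tnth (in_tuple w))
    (fun i j => [exists k, heap_edge i k && connect (@heap_edge w) k j]).

Definition heap_iso (H K : labelled_poset S) : Prop :=
  exists f : H -> K, [/\ bijective f,
    forall i, label (f i) = label i &
    forall i j, prec (f i) (f j) = prec i j].

Variable H : labelled_poset S.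
Implicit Types (a b i j x y z : H) (s t : S) (D : {set H}) (p u : seq H).

(* the subposet H_I *)
Definition subheap (I : {set S}) : {set H} := [set x | label x \in I].

Definition minimal_in D a : bool :=
  (a \in D) && [forall x in D, ~~ prec x a].

Definition maximal_in D b : bool :=
  (b \in D) && [forall x in D, ~~ prec b x].

Definition chain_cover i j : bool :=
  prec i j &&
  ((m_ge3 (label i) (label j) &&
    ~~ [exists z, [&& (label z == label i) || (label z == label j),
                      prec i z & prec z j]])
   || ((label i == label j) && ~~ [exists z, prec i z && prec z j])).

(* The relation of the cylindric transformation H^c. A point comparable to no
   other point is both minimal and maximal in H, so cyl_cover a a holds for it
   by the second clause; such loops are not coverings between two points, and
   have to be discarded when points with equal labels are considered. *)
Definition cyl_cover b a : bool :=
  [|| chain_cover b a,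
      [exists s, [&& minimal_in (subheap [set s]) a,
                     maximal_in (subheap [set s]) b,
                     minimal_in [set: H] a & maximal_in [set: H] b]]
    | [exists s, exists t, [&& m_ge3 s t,
                     minimal_in (subheap [set s; t]) a,
                     maximal_in (subheap [set s; t]) b & label a != label b]]].

(* The chain is the non-empty sequence x :: p; i_1, ..., i_k is x :: take k' p
   with k = k' + 1, and i_m is last x p. *)
Definition cylindric_convex_chain s t x p : Prop :=
  [/\ m_ge3 s t,
      3 <= size (x :: p),
      path cyl_cover x p && uniq (x :: p),
      [seq label i | i <- x :: p]
        = mkseq (fun k => if odd k then t else s) (size (x :: p)) &
      forall k u,
        path cyl_cover x (take k p ++ rcons u (last x p)) ->
        uniq (x :: take k p ++ rcons u (last x p)) ->
        {subset u <= x :: p}].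

End Heaps.

(* Main.v *)
Require Import Defs.
From mathcomp Require Import all_boot.
From HB Require Import structures.
From mathcomp Require Import ssralg poly polydiv matrix ssrnum algC cyclotomic.
From mathcomp Require Import zify.
From mathcomp Require boolp.

Set Implicit Arguments.
Unset Strict Implicit.
Unset Printing Implicit Defensive.

(** The statement splits into a group-theoretic half and a combinatorial half.

    Group theory.  Two reduced words of the same element are connected by braid
    moves ([matsumoto]), and a word that is not reduced becomes, after braid
    moves, a word with two equal adjacent letters ([tits_deletion]).  Hence a
    word whose commutation class meets neither a factor [ss] nor an alternating
    factor in [s], [t] of length [m s t >= 3] is reduced and fully commutative,
    since the only braid moves that apply to its class are commutations;
    conversely both kinds of factor are excluded for a reduced word of a fully
    commutative element.  Both theorems follow from the exchange property, read
    off from the parity of the number of times that a reflection occurs among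
    the reflections of a word ([reflections_parity]), together with the fact
    that [gen s * gen t] has order exactly [m s t] ([gen_order]), for which a
    linear representation over the algebraic numbers is exhibited.

    Combinatorics.  The points of a heap are kept fixed and only their linear
    order [q] varies, by commutations and by rotations.  The covering relation
    of the cylindric transformation is expressed by successors in the cyclic
    words obtained from [q] by keeping two labels ([cyl_coverE]), which makes
    its invariance under both moves evident ([cyc_cover_swap],
    [cyc_cover_rot]).  So the conditions of the theorem are invariant as well,
    and it remains to compare them with factors of the words that are reached.
    A factor [ss] gives a covering relation between equal labels, and a long
    alternating factor gives a convex chain: within such a factor, a point with
    two points of the factor after it has only one successor, and a point with
    two points of the factor before it has only one predecessor
    ([factor_convex]).  Conversely, after a rotation that brings the first point
    of a convex chain to the front, the chain is an interval of a linear heap,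
    and commutations gather an interval into a factor ([gather_convex]);
    the case of equal labels is [gather_equal].  One rotation of the given
    word is enough, as the definition of cyclic full commutativity requires. *)

(** * Alternating words and sequences *)

Definition alternating (T : Type) (s t : T) n :=
  mkseq (fun k => if odd k then t else s) n.

Lemma alternatingS (T : Type) (s t : T) n :
  alternating s t n.+1 = s :: alternating t s n.
Proof.
rewrite /alternating /mkseq /= (iotaDl 1 0) -map_comp; congr cons.
by apply: eq_map => k /=; case: odd.
Qed.

Lemma size_alternating (T : Type) (s t : T) n : size (alternating s t n) = n.
Proof. exact: size_mkseq. Qed.

Lemma alternating_suffix (T : Type) (s t : T) n (u w : seq T) :
  alternating s t n = u ++ w ->
  w = alternating s t (size w) \/ w = alternating t s (size w).
Proof.
elim: u n s t => [|x u IHu] n s t /=.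
  by move=> <-; left; rewrite size_alternating.
case: n => // n; rewrite alternatingS => -[_ /IHu[]]; [by right | by left].
Qed.

Lemma next_head (T : eqType) (x : T) (u : seq T) : next (x :: u) x = head x u.
Proof. by case: u => [|y u] /=; rewrite eqxx. Qed.

(** Filtering commutes with rotating, so the successor of [x] is read after
    rotating [x] to the front. *)
Lemma next_filter (T : eqType) (P : pred T) (a : seq T) (x : T) (b : seq T) :
  uniq (a ++ x :: b) -> P x ->
  next (filter P (a ++ x :: b)) x = head x (filter P b ++ filter P a).
Proof.
move=> uniq_q Px; have := filter_uniq P uniq_q; rewrite filter_cat /= Px => uniq_f.
by rewrite -(next_rot (size (filter P a)) uniq_f) rot_size_cat next_head.
Qed.

Lemma index_cat_cons (T : eqType) (a : seq T) (x : T) (b : seq T) :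
  uniq (a ++ x :: b) -> index x (a ++ x :: b) = size a.
Proof.
rewrite cat_uniq => /and3P[_ /hasPn/(_ x (mem_head _ _)) x_a _].
by rewrite index_cat (negPf x_a) /= eqxx addn0.
Qed.

Lemma split_index (T : eqType) (q : seq T) (y z : T) :
  uniq q -> z \in q -> index y q < index z q ->
  exists a c d, q = a ++ y :: c ++ z :: d.
Proof.
move=> uniq_q z_q lt_yz.
have y_q : y \in q by rewrite -index_mem (ltn_trans lt_yz) ?index_mem.
case/splitPr: y_q uniq_q z_q lt_yz => a b uniq_q.
rewrite index_cat_cons // mem_cat inE => /or3P[z_a|/eqP->|/splitPr[c d] _].
- by rewrite index_cat z_a ltnNge ltnW // index_mem.
- by rewrite index_cat_cons ?ltnn.
- by exists a, c, d.
Qed.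

Lemma pairwise_index (T : eqType) (q : seq T) : uniq q ->
  pairwise (fun y z => index y q < index z q) q.
Proof.
case: q => // x0 q uniq_q; apply/(pairwiseP x0) => i j lt_i lt_j lt_ij.
by rewrite !index_uniq.
Qed.

(** A path without repetition that starts at [x] and avoids [a] cannot go around
    the cycle, so it reads the word after [x]. *)
Lemma fpath_next_prefix (T : eqType) (a : seq T) (x : T) (r p : seq T) :
  uniq (a ++ x :: r) -> uniq (a ++ x :: p) ->
  fpath (next (a ++ x :: r)) x p -> exists r', r = p ++ r'.
Proof.
elim: p a x r => [|y p IHp] a x r uniq_r uniq_p /=; first by exists r.
case/andP=> /eqP next_x path_p.
have := next_rot (size a) uniq_r x; rewrite rot_size_cat cat_cons next_head next_x.
case: r uniq_r next_x path_p => [|z r] uniq_r next_x path_p /=.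
  move=> y_a; have: y \in a ++ [:: x].
    by rewrite -y_a; case: (a) => [|? ?]; rewrite ?mem_cat /= mem_head ?orbT.
  move: uniq_p; rewrite -cat_rcons cat_uniq -cats1 => /and3P[_ /hasPn/(_ y)].
  by rewrite mem_head => /(_ isT) /negPf ->.
move=> eq_zy; subst z.
have [|||r' ->] := IHp (rcons a x) y r; rewrite ?cat_rcons //.
by exists r'.
Qed.

(** * Actions of a Coxeter group *)

(** The group of all bijections of a type, composed from left to right, is the
    target to which the universal property of the presentation is applied. *)
Section Bijections.
Import Algebra.
Local Open Scope group_scope.
Variable T : Type.

Record bijection := Bijection {
  bij_fun :> T -> T;
  bij_inv : T -> T;
  bij_funK : cancel bij_fun bij_inv;
  bij_invK : cancel bij_inv bij_fun }.

Lemma bijection_eq (f g : bijection) : f =1 g -> f = g.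
Proof.
case: f g => [f f' fK f'K] [g g' gK g'K] /= /boolp.funext eq_fg.
have eq_inv : f' = g'.
  by apply: boolp.funext => x; rewrite -{2}[x]f'K eq_fg gK.
case: g / eq_fg gK g'K => gK g'K; case: g' / eq_inv gK g'K => gK g'K.
by congr Bijection; apply: boolp.Prop_irrelevance.
Qed.

Definition bij_one := @Bijection id id (fun=> erefl) (fun=> erefl).
Definition bij_mul (f g : bijection) : bijection :=
  Bijection (can_comp (@bij_funK g) (@bij_funK f))
            (can_comp (@bij_invK f) (@bij_invK g)).
Definition bij_opp (f : bijection) := Bijection (@bij_invK f) (@bij_funK f).

HB.instance Definition _ := boolp.gen_eqMixin bijection.
HB.instance Definition _ := boolp.gen_choiceMixin bijection.

Lemma bij_mulA : associative bij_mul.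
Proof. by move=> f g h; apply: bijection_eq. Qed.
Lemma bij_mul1 : left_id bij_one bij_mul.
Proof. by move=> f; apply: bijection_eq. Qed.
Lemma bij_mulr1 : right_id bij_one bij_mul.
Proof. by move=> f; apply: bijection_eq. Qed.
Lemma bij_mulV : left_inverse bij_one bij_opp bij_mul.
Proof. by move=> f; apply: bijection_eq => x /=; rewrite bij_invK. Qed.
Lemma bij_mulrV : right_inverse bij_one bij_opp bij_mul.
Proof. by move=> f; apply: bijection_eq => x /=; rewrite bij_funK. Qed.

HB.instance Definition _ :=
  isGroup.Build bijection bij_mulA bij_mul1 bij_mulr1 bij_mulV bij_mulrV.

Lemma bij_mulE (f g : bijection) x : (f * g) x = g (f x).
Proof. by []. Qed.

Lemma bij_expE (f : bijection) n x : (f ^+ n) x = iter n f x.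
Proof.
elim: n x => [|n IHn] x //.
by rewrite expgS bij_mulE IHn iterSr.
Qed.

End Bijections.

(** * Products of two reflections of a linear representation *)
Section RankOne.
Import GRing.Theory.
Local Open Scope ring_scope.

(** A number whose square has multiplicative order exactly [n]; for [n = 0] the
    square is [4], which has infinite order.  With [z = half_angle n], the
    number [- (z + z^-1)] plays the role of [-2 cos (pi / n)]. *)
Definition half_angle n : algC :=
  if n is n'.+1 then sval (C_prim_root_exists (isT : (0 < n'.+1.*2)%N)) else 2.

Lemma half_angle_neq0 n : half_angle n != 0.
Proof.
case: n => [|n] /=; first by rewrite Num.Theory.pnatr_eq0.
case: C_prim_root_exists => z /= prim_z.
apply/eqP=> z0; have := prim_expr_order prim_z.
by rewrite z0 expr0n /= => /esym/eqP; rewrite oner_eq0.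
Qed.

Lemma half_angle_order n k : (half_angle n ^+ k.*2 == 1) = (n %| k)%N.
Proof.
case: n => [|n] /=.
  rewrite dvd0n -muln2 mulnC exprM -natrX Num.Theory.pexprn_eq1 ?Num.Theory.ler0n //.
  by rewrite Num.Theory.pnatr_eq1 orbF.
case: C_prim_root_exists => z /= prim_z.
by rewrite -(prim_order_dvd prim_z) -!muln2 dvdn_pmul2r.
Qed.

Lemma half_angle1 : half_angle 1 = -1.
Proof.
rewrite /=; case: C_prim_root_exists => z /= prim_z.
have := prim_expr_order prim_z => /eqP; rewrite sqrf_eq1 => /predU1P[z1|/eqP //].
by have := prim_order_dvd prim_z 1; rewrite z1 expr1n eqxx.
Qed.

(** [M = (1 - P) * (1 - Q)] is annihilated by [(X - 1) (X - q) (X - q^-1)] with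
    [q = z ^+ 2], and for [n > 2] these are three distinct roots of
    [X ^ n - 1]. *)
Lemma rank_one_product (A : algType algC) (P Q : A) n (z := half_angle n) :
  P * P = 2 *: P -> Q * Q = 2 *: Q ->
  P * Q * P = (z + z^-1) ^+ 2 *: P -> Q * P * Q = (z + z^-1) ^+ 2 *: Q ->
  (2 < n)%N -> ((1 - P) * (1 - Q)) ^+ n = 1.
Proof.
move=> PP QQ PQP QPQ n_gt2.
have z_neq0 : z != 0 := half_angle_neq0 n.
have zV_neq0 : z^-1 != 0 by rewrite invr_eq0.
pose M := (1 - P) * (1 - Q); pose N := (1 - Q) * (1 - P).
have invol B : B * B = 2 *: B -> (1 - B) * (1 - B) = 1 :> A.
  move=> BB; rewrite mulrBr mulr1 mulrBl mul1r BB scaler_nat mulr2n.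
  by rewrite opprB addrK subrK.
have NM : N * M = 1.
  by rewrite /N /M mulrA -(mulrA (1 - Q)) invol // mulr1 invol.
pose q := z ^+ 2; pose r := z^-1 ^+ 2.
have qr : q * r = 1 by rewrite -exprMn divff ?expr1n.
have qE k : (q ^+ k == 1) = (n %| k)%N by rewrite -half_angle_order -mul2n exprM.
have c2 : (z + z^-1) ^+ 2 = q + r + 2.
  by rewrite sqrrD divff // addrAC.
clearbody q r.
have ME : M - 1 = - P - Q + P * Q.
  rewrite /M mulrBr mulr1 mulrBl mul1r opprB addrA.
  by rewrite [1 - P]addrC addrAC -!addrA; congr (_ + _); rewrite addrC !addrA addrNK addrC.
have kill (B C : A) : B * B = 2 *: B -> B * C * B = (z + z^-1) ^+ 2 *: B ->
    B * ((1 - B) * (1 - C) + (1 - C) * (1 - B) - (q + r)%:A) = 0.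
  move=> BB BCB; rewrite mulrBr mulrDr !mulrA.
  have -> : B * (1 - B) = - B by rewrite mulrBr mulr1 BB scaler_nat mulr2n opprD addNKr.
  rewrite mulNr !(mulrBr B) mulr1 [(B - _) * _]mulrBr mulr1 mulrBl BB BCB addKr.
  by rewrite -scalerAr mulr1 c2 opprB scalerDl addrK subrr.
(* [M - 1] is a sum of left multiples of [P] and [Q], both of which are
   killed on the right by [M + M^-1 - (q + q^-1)] *)
have L0 : (M - 1) * (M + N - (q + r)%:A) = 0.
  rewrite ME mulrDl mulrBl -mulrA.
  have QL : Q * (M + N - (q + r)%:A) = 0 by rewrite (addrC M) kill.
  by rewrite QL mulr0 mulNr kill // !(oppr0, addr0).
have cubic : (M - 1) * ((M - q%:A) * (M - r%:A)) = 0.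
  suff -> : (M - q%:A) * (M - r%:A) = (M + N - (q + r)%:A) * M.
    by rewrite mulrA L0 mul0r.
  rewrite [RHS]mulrBl [(M + N) * M]mulrDl NM mulrBr mulrBl
    -!scalerAr -!scalerAl.
  rewrite !mulr1 !mul1r.
  by rewrite scalerBr scalerA [r * q]mulrC qr scale1r opprB addrACA -opprD -scalerDl.
have q_neq1 : q != 1 by rewrite -[q]expr1 qE dvdn1 gtn_eqF // ltnW.
have uniq_qr : uniq [:: 1; q; r].
  rewrite /= !inE eq_sym negb_or q_neq1 andbT /=; apply/andP; split.
    by apply: contra q_neq1 => /eqP r1; rewrite -qr -r1 mulr1.
  apply/eqP => eq_qr; have : q ^+ 2 == 1 by rewrite expr2 {2}eq_qr qr.
  by rewrite qE => /(dvdn_leq (isT : (0 < 2)%N)); rewrite leqNgt n_gt2.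
have divs : (('X - 1%:P) * (('X - q%:P) * ('X - r%:P)) %| ('X^n - 1 : {poly algC}))%R.
  have := @uniq_roots_dvdp _ ('X^n - 1) [:: 1; q; r].
  rewrite !big_cons big_nil mulr1; apply; last by rewrite uniq_rootsE.
  have qn1 : q ^+ n = 1 by apply/eqP; rewrite qE.
  have rn1 : r ^+ n = 1 by rewrite -[LHS]mul1r -{1}qn1 -exprMn qr expr1n.
  by rewrite /= /root !hornerE expr1n qn1 rn1 subrr eqxx.
have /dvdpP[p defp] := divs.
have := congr1 (horner_alg M) defp.
rewrite !rmorphM !rmorphB /= !horner_algC horner_algX.
rewrite rmorphXn /= horner_algX. rewrite !scale1r cubic mulr0.
by move/eqP; rewrite subr_eq0 => /eqP.
Qed.
End RankOne.

Section Evaluation.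
Import Algebra.
Local Open Scope group_scope.
Lemma eval_nil (S : finType) (W : groupType) (gen : S -> W) :
  word_eval gen [::] = 1.
Proof. exact: big_nil. Qed.

Lemma eval_cons (S : finType) (W : groupType) (gen : S -> W) s w :
  word_eval gen (s :: w) = gen s * word_eval gen w.
Proof. exact: big_cons. Qed.

Lemma eval_cat (S : finType) (W : groupType) (gen : S -> W) u v :
  word_eval gen (u ++ v) = word_eval gen u * word_eval gen v.
Proof. exact: big_cat. Qed.

End Evaluation.

(** * Reflections and the exchange property *)
Section Coxeter.
Import Algebra.
Local Open Scope group_scope.
Variables (S : finType) (m : S -> S -> nat) (W : groupType) (gen : S -> W).
Hypothesis hW : coxeter_system m gen.
Implicit Types (s t : S) (u v w a b : seq S).
Local Notation eval := (word_eval gen).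
Local Notation red := (reduced gen).

Lemma m_diag s : m s s = 1%N. Proof. by case: hW => -[]. Qed.
Lemma m_sym s t : m s t = m t s. Proof. by case: hW => -[_ + _] _ _; apply. Qed.
Lemma m_eq1 s t : m s t = 1%N -> s = t.
Proof.
case: hW => -[_ _ m_neq1] _ _ m1; apply/eqP/negPn/negP => /m_neq1.
by rewrite m1.
Qed.

Lemma gen_braid s t : (gen s * gen t) ^+ m s t = 1.
Proof. by case: hW. Qed.

Lemma genK s : gen s * gen s = 1.
Proof. by have := gen_braid s s; rewrite m_diag. Qed.

Lemma genV s : (gen s)^-1 = gen s.
Proof. by exact: mulg1_eq (genK s). Qed.

Lemma genMK s : involutive ( *%g (gen s)).
Proof. by move=> x; rewrite mulgA genK mul1g. Qed.

(** The universal property in the form in which it is used: an action of the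
    letters that satisfies the relations depends only on the element that a
    word represents. *)
Lemma word_action (T : Type) (act : S -> T -> T) :
  (forall s, involutive (act s)) ->
  (forall s t x, iter (m s t) (act t \o act s) x = x) ->
  forall u v, eval u = eval v ->
  forall x, foldl (fun y s => act s y) x u = foldl (fun y s => act s y) x v.
Proof.
move=> actK act_braid u v eq_uv x.
pose f s : bijection T := Bijection (actK s) (actK s).
have [|phi phiE] := proj1 (let: And3 _ _ h := hW in h _ f _).
  by move=> s t; apply: bijection_eq => y; rewrite bij_expE; apply: act_braid.
suff evalE w y : phi (eval w) y = foldl (fun y s => act s y) y w.
  by rewrite -!evalE eq_uv.
elim: w y => [|s w IHw] y /=; last by rewrite eval_cons gmulfM phiE bij_mulE IHw.
rewrite eval_nil; suff -> : phi 1 = 1 by [].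
by apply: (mulgI (phi 1)); rewrite -gmulfM !mulg1.
Qed.

Lemma eval_alternating s t k : eval (alternating s t k.*2) = (gen s * gen t) ^+ k.
Proof.
elim: k => [|k IHk]; first exact: eval_nil.
by rewrite doubleS !alternatingS !eval_cons IHk expgS mulgA.
Qed.

Lemma foldl_alternating (T : Type) (act : S -> T -> T) s t n x :
  foldl (fun y s => act s y) x (alternating s t n.*2)
  = iter n (act t \o act s) x.
Proof. by elim: n x => // n IHn x; rewrite iterSr -IHn doubleS !alternatingS. Qed.

(** The reflections [s_1 ... s_(i-1) s_i s_(i-1) ... s_1]: multiplying the word
    on the left by one of them deletes the letter [s_i]. *)
Fixpoint reflections w : seq W :=
  if w is s :: u then gen s :: [seq gen s * y * gen s | y <- reflections u]
  else [::].

Lemma conj_genK s : involutive (fun y => gen s * y * gen s).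
Proof. by move=> y; rewrite !mulgA genK mul1g -mulgA genK mulg1. Qed.

Lemma conj_gen_eq s y : (gen s * y * gen s == gen s) = (y == gen s).
Proof.
rewrite -(inj_eq (inv_inj (conj_genK s))) conj_genK -mulgA genK mulg1.
by rewrite eq_sym [RHS]eq_sym.
Qed.

Lemma reflectionsP x w : x \in reflections w ->
  exists a b, size (a ++ b) < size w /\ x * eval w = eval (a ++ b).
Proof.
elim: w x => [|s u IHu] x //=; rewrite inE => /predU1P[->|].
  by exists [::], u; rewrite eval_cons genMK.
case/mapP=> y /IHu[a [b [lt_u eval_u]]] ->; exists (s :: a), b; split=> //=.
by rewrite /= !eval_cons -eval_u -mulgA genMK mulgA.
Qed.

Lemma reflections_alternating s t k :
  reflections (alternating s t k)
  = [seq (gen s * gen t) ^+ i * gen s | i <- iota 0 k].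
Proof.
elim: k s t => // k IHk s t; rewrite alternatingS /= expg0 mul1g; congr cons.
rewrite IHk -map_comp (iotaDl 1 0) -map_comp; apply: eq_map => i /=.
rewrite add1n; elim: i => [|i IHi]; first by rewrite expg0 mul1g expg1.
by rewrite expgS [in RHS]expgS -[RHS]mulgA -IHi !mulgA.
Qed.

(** The letters act on pairs of a group element and a sign: [s] conjugates the
    element by [gen s] and changes the sign when the element is [gen s].  The
    sign then records the parity in question.  The relations hold because the
    [2 m] reflections of [(st)^m] are [m] reflections listed twice. *)
Lemma reflections_parity x u v : eval u = eval v ->
  odd (count_mem x (reflections u)) = odd (count_mem x (reflections v)).
Proof.
pose act s (p : W * bool) := (gen s * p.1 * gen s, p.2 (+) (p.1 == gen s)).
have actK s : involutive (act s).
  by case=> y b; rewrite /act /= conj_genK conj_gen_eq addbK.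
have actE w y (b : bool) : foldl (fun p s => act s p) (y, b) w
    = ((eval w)^-1 * y * eval w, b (+) odd (count_mem y (reflections w))).
  elim: w y b => [|s w IHw] y b /=.
    by rewrite eval_nil invg1 mul1g mulg1 addbF.
  rewrite {}IHw eval_cons invgM genV !mulgA; congr (_, _).
  rewrite count_map oddD oddb -addbA eq_sym; congr (_ (+) (_ (+) odd _)).
  apply: eq_count => z /=.
  by rewrite -(inj_eq (inv_inj (conj_genK s))) conj_genK.
move=> eq_uv; suff actW p : foldl (fun p s => act s p) p u
    = foldl (fun p s => act s p) p v.
  by have := actW (x, false); rewrite !actE => -[].
apply: (word_action actK) eq_uv p => s t p.
rewrite -foldl_alternating; case: p => y b; rewrite actE.
rewrite eval_alternating gen_braid invg1 mul1g mulg1.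
rewrite reflections_alternating -addnn iotaD map_cat count_cat add0n.
congr (_, _); rewrite -{2}[m s t]addn0 iotaDl -map_comp.
rewrite (@eq_map _ _ (_ \o _) (fun i => (gen s * gen t) ^+ i * gen s)).
  by rewrite oddD addbb addbF.
by move=> i /=; rewrite expgnDr gen_braid mul1g.
Qed.

(** * The order of a product of two generators *)

(** The geometric representation, acting on row vectors.  The form is not
    required to be positive, so any algebraic numbers with the right orders may
    replace the cosines; the extra coordinate [ord0] only makes the dimension a
    successor, so that square matrices form a ring. *)
Section Order.
Import GRing.Theory.
Local Open Scope ring_scope.

Let cartan s t : algC := - (half_angle (m s t) + (half_angle (m s t))^-1).
Let root s : 'rV[algC]_#|S|.+1 := delta_mx ord0 (lift ord0 (enum_rank s)).
Let coroot s : 'cV[algC]_#|S|.+1 :=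
  \col_i (if unlift ord0 i is Some j then cartan s (enum_val j) else 0).
Let refl s : 'M[algC]_#|S|.+1 := coroot s *m root s.

Let cartan_diag s : cartan s s = 2.
Proof. by rewrite /cartan m_diag half_angle1 invrN1 opprD opprK. Qed.

Let cartan_sym s t : cartan s t = cartan t s.
Proof. by rewrite /cartan m_sym. Qed.

Let rootM s t : root t *m coroot s = (cartan s t)%:M.
Proof.
apply/matrixP => i j; rewrite -rowE !ord1 !mxE liftK enum_rankK.
by rewrite eqxx mulr1n.
Qed.

Let reflM s t : refl s * refl t = cartan s t *: (coroot s *m root t).
Proof.
rewrite /refl [LHS]mulmxA -(mulmxA (coroot s)) rootM cartan_sym.
by rewrite scalar_mxC mul_scalar_mx -scalemxAl.
Qed.

Let refl2 s : refl s * refl s = 2 *: refl s.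
Proof. by rewrite reflM cartan_diag. Qed.

Let refl3 s t : refl s * refl t * refl s = cartan s t ^+ 2 *: refl s.
Proof.
rewrite reflM -scalerAl; rewrite [_ * _]mulmxA -(mulmxA (coroot s)) rootM.
by rewrite scalar_mxC mul_scalar_mx -scalemxAl scalerA.
Qed.

Let refl_action s (x : 'rV[algC]_#|S|.+1) := x *m (1 - refl s).

Let refl1K s : (1 - refl s) * (1 - refl s) = 1.
Proof.
by rewrite mulrBr mulr1 mulrBl mul1r refl2 scaler_nat mulr2n opprB addrK subrK.
Qed.

Let refl_actionK s : involutive (refl_action s).
Proof.
move=> x; rewrite /refl_action -mulmxA -[(1 - _) *m _]/((1 - _) * (1 - _)).
by rewrite refl1K mulmx1.
Qed.

Let iter_action s t n x :
  iter n (refl_action t \o refl_action s) x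
  = x *m ((1 - refl s) * (1 - refl t)) ^+ n.
Proof.
elim: n => [|n IHn] /=; first by rewrite expr0 mulmx1.
by rewrite {}IHn /refl_action exprSr -!mulmxA.
Qed.

Let braid_action s t x : iter (m s t) (refl_action t \o refl_action s) x = x.
Proof.
rewrite iter_action; case: (ltnP 2 (m s t)) => [m_gt2 | ].
  rewrite rank_one_product ?mulmx1 // refl3 ?(cartan_sym t) /cartan sqrrN //.
case Dm: (m s t) => [|[|[|//]]] _; first by rewrite expr0 mulmx1.
  by rewrite (m_eq1 Dm) expr1 [LHS]mulmxA; apply: refl_actionK.
have cartan0 : cartan s t = 0.
  rewrite /cartan Dm; set z := half_angle 2.
  have z_neq0 : z != 0 := half_angle_neq0 2.
  have z2 : z ^+ 2 = -1.
    have := half_angle_order 2 2; rewrite dvdnn -[2.*2]/(2 * 2)%N exprM sqrf_eq1 => /orP[|/eqP //].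
    by have := half_angle_order 2 1; rewrite dvdn1 => /= ->.
  by rewrite -[z^-1]mul1r -[1]opprK -z2 mulNr expr2 mulfK // subrr oppr0.
have comm : (1 - refl s) * (1 - refl t) = (1 - refl t) * (1 - refl s).
  rewrite !mulrBr !mulrBl !mulr1 !mul1r !reflM (cartan_sym t) cartan0.
  by rewrite !scale0r !subr0 addrAC.
rewrite expr2 {1}comm mulrA -(mulrA (1 - refl t)) refl1K mulr1 refl1K.
by rewrite mulmx1.
Qed.

Lemma gen_order s t k : ((gen s * gen t) ^+ k = 1)%g -> (m s t %| k)%N.
Proof.
have [->|neq_st] := eqVneq s t; first by rewrite m_diag dvd1n.
move=> order_k; set z := half_angle (m s t).
pose x := root s + z *: root t.
have := @word_action _ refl_action refl_actionK braid_action (alternating s t k.*2) [::].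
rewrite eval_alternating order_k eval_nil => /(_ erefl x).
rewrite foldl_alternating iter_action /=.
(* [x] is an eigenvector of the product of the two reflections *)
have eigen : x *m ((1 - refl s) * (1 - refl t)) = z ^+ 2 *: x.
  have z_neq0 : z != 0 := half_angle_neq0 _.
  have cartanE : cartan s t = - (z + z^-1) by [].
  have rootE (u v : S) : root v *m (1 - refl u) = root v - cartan u v *: root u.
    by rewrite mulmxBr mulmx1 mulmxA rootM mul_scalar_mx.
  rewrite [LHS]mulmxA mulmxDl -scalemxAl !rootE cartan_diag cartanE.
  have double (u : S) : root u - 2 *: root u = - root u.
    by rewrite scaler_nat mulr2n opprD addNKr.
  have -> : root s - 2 *: root s + z *: (root t - - (z + z^-1) *: root s)
      = z ^+ 2 *: root s + z *: root t.
    rewrite double scalerBr scaleNr scalerN opprK scalerA mulrDr divff // -expr2.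
    by rewrite scalerDl scale1r addrC -addrA addrK addrC.
  rewrite mulmxDl -!scalemxAl !rootE cartan_diag double (cartan_sym t) cartanE.
  rewrite scaleNr opprK.
  rewrite /x !scalerDr !scalerA mulrDr {2}expr2 mulfK // scalerDl scalerN.
  by rewrite addrA addrK.
have -> : x *m ((1 - refl s) * (1 - refl t)) ^+ k = z ^+ k.*2 *: x.
  elim: k {order_k} => [|k IHk]; first by rewrite expr0 mulmx1 scale1r.
  by rewrite exprS mulmxA eigen -scalemxAl IHk scalerA -exprD.
move/matrixP => /(_ ord0 (lift ord0 (enum_rank s))).
rewrite !mxE !eqxx /= (inj_eq (@lift_inj _ _)) (inj_eq enum_rank_inj).
rewrite (negPf neq_st) mulr0 addr0 mulr1 => /eqP.
by rewrite half_angle_order.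
Qed.
End Order.

(** * Braid moves: the theorems of Matsumoto and Tits *)

(** For [m s t = 0] the move replaces the empty word by itself. *)
Inductive braid_equiv : seq S -> seq S -> Prop :=
| BraidRefl w : braid_equiv w w
| BraidStep a b s t w :
    braid_equiv (a ++ alternating t s (m s t) ++ b) w ->
    braid_equiv (a ++ alternating s t (m s t) ++ b) w.

Lemma braid_trans u v w : braid_equiv u v -> braid_equiv v w -> braid_equiv u w.
Proof. by elim=> // a b s t v' _ IH /IH; apply: BraidStep. Qed.

Lemma braid_sym u v : braid_equiv u v -> braid_equiv v u.
Proof.
elim=> [w | a b s t w _ IH]; first exact: BraidRefl.
apply: braid_trans IH _; rewrite -(m_sym t s).
exact/BraidStep/BraidRefl.
Qed.

Lemma braid_catl a u v : braid_equiv u v -> braid_equiv (a ++ u) (a ++ v).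
Proof.
elim=> [w | a' b s t w _ IH]; first exact: BraidRefl.
by rewrite catA; apply: BraidStep; rewrite -catA.
Qed.

Lemma eval_alternatingV s t k :
  eval (alternating s t k) = (gen s * gen t) ^+ k * eval (alternating t s k).
Proof.
elim: k s t => [|k IHk] s t; first by rewrite mul1g.
rewrite !alternatingS !eval_cons IHk expgS -!mulgA; congr (_ * _).
suff -> : (gen t * gen s) ^+ k = gen t * ((gen s * gen t) ^+ k * gen t).
  by rewrite -!mulgA.
elim: k {IHk} => [|k IHk]; first by rewrite mul1g genK.
by rewrite expgSr IHk [in RHS]expgSr -!mulgA genMK genK mulg1.
Qed.

Lemma eval_braid s t :
  eval (alternating s t (m s t)) = eval (alternating t s (m s t)).
Proof. by rewrite eval_alternatingV gen_braid mul1g. Qed.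

Lemma reduced_catr a u : red (a ++ u) -> red u.
Proof.
move=> red_au v eq_vu; rewrite -(leq_add2l (size a)) -!size_cat.
by apply: red_au; rewrite !eval_cat eq_vu.
Qed.

Lemma reduced_eval u v : red u -> eval u = eval v -> size v <= size u -> red v.
Proof.
move=> red_u eq_uv le_vu x eq_xv; apply: leq_trans le_vu _.
by apply: red_u; rewrite eq_xv.
Qed.

Lemma count_conj_gen s r :
  count_mem (gen s) [seq gen s * y * gen s | y <- r] = count_mem (gen s) r.
Proof. by rewrite count_map; apply: eq_count => y; apply: conj_gen_eq. Qed.

(** The exchange property: the first letter of a reduced word is a reflection
    of every word of the same element, since it occurs exactly once in the
    first list and the parities agree. *)
Lemma gen_mem_reflections s u w :
  red (s :: u) -> eval w = eval (s :: u) -> gen s \in reflections w.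
Proof.
move=> red_su /(reflections_parity (gen s)) /=.
rewrite eqxx count_conj_gen.
rewrite (count_memPn _) => [/= odd_w|].
  by rewrite -has_pred1 has_count; case: count odd_w.
apply/negP => /reflectionsP[a [b [lt_ab eval_ab]]].
have := red_su (a ++ b); rewrite -eval_ab eval_cons => /(_ erefl).
by rewrite leqNgt ltnW.
Qed.

Lemma reflections_cat u v :
  reflections (u ++ v)
  = reflections u ++ [seq eval u * y * (eval u)^-1 | y <- reflections v].
Proof.
elim: u => [|s u IHu] /=.
  rewrite (@eq_map _ _ _ id) ?map_id // => y.
  by rewrite eval_nil invg1 mulg1 mul1g.
rewrite IHu map_cat -map_comp; congr (_ :: _ ++ _).
by apply: eq_map => y /=; rewrite eval_cons invgM genV !mulgA.
Qed.

(** By exchange, [t] deletes a letter of the word.  That letter is not in the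
    alternating part, as [gen s * gen t] would have an order smaller than
    [m s t]; so [t] can be put in front at the expense of a letter of [r]. *)
Lemma descent_alternating s t k r u :
  red (t :: u) -> eval (alternating s t k ++ r) = eval (t :: u) ->
  (m s t == 0) || (k < m s t) ->
  exists r', eval (alternating t s k.+1 ++ r') = eval (t :: u)
             /\ size r' < size r.
Proof.
move=> red_tu eval_w lt_km.
have := gen_mem_reflections red_tu eval_w.
rewrite reflections_cat mem_cat reflections_alternating => /orP[] /mapP[].
  move=> i; rewrite mem_iota add0n /= => lt_ik gen_t.
  have /gen_order : (gen s * gen t) ^+ i.+1 = 1.
    by rewrite expgSr mulgA -gen_t genK.
  case/orP: lt_km => [/eqP-> | lt_km]; first by rewrite dvd0n.
  by move/dvdn_leq => /(_ isT); rewrite leqNgt (leq_ltn_trans lt_ik).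
move=> y /reflectionsP[a [b [lt_ab eval_ab]]] gen_t.
exists (a ++ b); split=> //; rewrite alternatingS -eval_w cat_cons eval_cons.
have EyE : eval (alternating s t k) * y = gen t * eval (alternating s t k).
  by rewrite gen_t mulgVK.
by rewrite eval_cat [RHS]eval_cat -eval_ab [eval _ * _]mulgA EyE -mulgA genMK.
Qed.

(** The exchange is applied in turn with [s] and with [t], the alternating
    prefix growing by one letter each time. *)
Lemma two_descents_alternating s t u v k :
  red (s :: u) -> red (t :: v) -> eval (s :: u) = eval (t :: v) ->
  (m s t == 0) || (k <= m s t) ->
  exists r, eval (alternating s t k ++ r) = eval (s :: u)
    /\ size (alternating s t k ++ r) <= size (s :: u).
Proof.
elim: k s t u v => [|k IHk] s t u v red_u red_v eq_uv le_km.
  by exists (s :: u).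
have size_vu : size (t :: v) <= size (s :: u) by apply: red_v.
have lt_km : (m t s == 0) || (k < m t s) by rewrite m_sym.
have [r [eval_r size_r]] : exists r, eval (alternating t s k ++ r) = eval (t :: v)
    /\ size (alternating t s k ++ r) <= size (t :: v).
  by apply: IHk (esym eq_uv) _ => //; case/orP: lt_km => [->|/ltnW->]; rewrite ?orbT.
rewrite -eq_uv in eval_r.
have [r' [eval_r' size_r']] := descent_alternating red_u eval_r lt_km.
exists r'; split=> //; apply: leq_trans size_vu; apply: leq_trans size_r.
by rewrite !size_cat !size_alternating addSnnS leq_add2l.
Qed.

(** When [m s t = 0] the alternating prefix could grow beyond the length of the
    word, so an element with descents [s] and [t] has a finite [m s t]. *)
Lemma two_descents s t u v :
  red (s :: u) -> red (t :: v) -> eval (s :: u) = eval (t :: v) ->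
  exists r, [/\ eval (alternating s t (m s t) ++ r) = eval (s :: u),
    size (alternating s t (m s t) ++ r) = size (s :: u) & 0 < m s t].
Proof.
move=> red_u red_v eq_uv.
have := two_descents_alternating (k := _) red_u red_v eq_uv.
case: (posnP (m s t)) => [-> | m_gt0] alt.
  have [r [_]] := alt (size (s :: u)).+1 isT.
  by rewrite size_cat size_alternating leqNgt ltnS leq_addr.
have [|r [eval_r size_r]] := alt (m s t); first by rewrite leqnn orbT.
by exists r; split=> //; apply/eqP; rewrite eqn_leq size_r red_u.
Qed.

(** Induction on the length.  Words with the same first letter are compared
    after removing it; otherwise both are compared with words that start with
    one of the two sides of the braid relation between the first letters. *)
Theorem matsumoto u v : red u -> red v -> eval u = eval v -> braid_equiv u v.
Proof.
have [n] := ubnP (size u); elim: n u v => // n IHn u v.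
case: u v => [|s u] [|t v] /= lt_un red_u red_v eq_uv.
- exact: BraidRefl.
- by have := red_v [::] eq_uv.
- by have := red_u [::] (esym eq_uv).
have IHs x w w' : red (x :: w) -> eval (x :: w) = eval (x :: w') ->
    size w' = size w -> size w < n -> braid_equiv (x :: w) (x :: w').
  move=> red_w eq_w eq_size lt_w; apply: (braid_catl [:: x]).
  have eq_ww' : eval w = eval w' by move: eq_w; rewrite !eval_cons => /mulgI.
  have red_w' := reduced_catr (a := [:: x]) red_w.
  by apply: IHn => //; apply: reduced_eval red_w' eq_ww' _; rewrite eq_size.
have size_uv : size u = size v.
  by apply/eqP; rewrite eqn_leq; apply/andP; split;
    [apply: (red_u (t :: v)) | apply: (red_v (s :: u))].
have [eq_st|neq_st] := eqVneq s t; first by subst t; apply: IHs.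
have [r [eval_r size_r m_gt0]] := two_descents red_u red_v eq_uv.
have [k Dk] : exists k, m s t = k.+1 by exists (m s t).-1; rewrite prednK.
have size_r' : size (alternating t s k ++ r) = size u.
  by move: size_r; rewrite Dk alternatingS => -[].
apply: (@braid_trans _ (alternating s t (m s t) ++ r)).
  by rewrite Dk alternatingS; apply: IHs; rewrite // -eval_r Dk alternatingS.
apply: (@BraidStep [::]); rewrite /= Dk alternatingS.
apply/braid_sym/IHs; rewrite -?size_uv //.
  rewrite -eq_uv -eval_r -cat_cons -alternatingS -Dk !eval_cat.
  by rewrite eval_braid.
by move: size_r'; rewrite !size_cat !size_alternating.
Qed.

(** For [s :: u] with [u] reduced, [gen s] must be a reflection of [u]; hence
    [u] has a reduced expression starting with [s], which braid moves reach. *)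
Theorem tits_deletion w : ~ red w ->
  exists a s b, braid_equiv w (a ++ s :: s :: b).
Proof.
elim: w => [[]|s u IHu nred_su]; first by move=> v _.
have [red_u|/IHu[a [t [b equiv_u]]]] := boolp.pselect (red u); last first.
  by exists (s :: a), t, b; apply: (braid_catl [:: s]).
have refl_s : gen s \in reflections u.
  apply/negPn/negP => s_notin; apply: nred_su => v eq_v.
  rewrite leqNgt; apply/negP => lt_v.
  have : gen s \in reflections v.
    have := reflections_parity (gen s) eq_v; rewrite /= eqxx count_conj_gen.
    by rewrite (count_memPn s_notin) -has_pred1 has_count; case: count.
  case/reflectionsP=> a [b [lt_ab eval_ab]].
  have := red_u (a ++ b); rewrite -eval_ab eq_v eval_cons genMK => /(_ erefl).
  by rewrite leqNgt (leq_trans lt_ab).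
have [a [b [lt_ab eval_ab]]] := reflectionsP refl_s.
exists [::], s, (a ++ b); apply: (braid_catl [:: s]) => /=.
have eq_u : eval u = eval (s :: a ++ b) by rewrite eval_cons -eval_ab genMK.
apply: matsumoto => //; exact: reduced_eval red_u eq_u _.
Qed.

(** Here the exact order of [gen s * gen t] is needed: generators with
    [m s t >= 3] might otherwise commute in [W]. *)
Lemma commute_gen s t : commute (gen s) (gen t) <-> ~~ m_ge3 m s t.
Proof.
split=> [comm_st|].
  have /gen_order : (gen s * gen t) ^+ 2 = 1.
    by rewrite expgMn // !expg2 !genK mulg1.
  by rewrite /m_ge3; case: (m s t) => [|[|[|n]]] //; rewrite gtnNdvd.
case Dm: (m s t) => [|[|[|n]]]; rewrite /m_ge3 Dm // => _.
  by rewrite (m_eq1 Dm).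
have := gen_braid s t; rewrite Dm expg2 => /mulg1_eq.
by rewrite invgM !genV /commute => ->.
Qed.

Lemma commutation_eval u v : commutation_equiv gen u v -> eval u = eval v.
Proof.
elim=> // a b s t w comm _ <-; rewrite !eval_cat !eval_cons; congr (_ * _).
by rewrite !mulgA comm.
Qed.

Lemma commutation_size u v : commutation_equiv gen u v -> size u = size v.
Proof. by elim=> // a b s t w _ _ <-; rewrite !size_cat. Qed.

Lemma commutation_filter u v s t : m_ge3 m s t -> commutation_equiv gen u v ->
  filter (pred2 s t) u = filter (pred2 s t) v.
Proof.
move=> m_st; elim=> // a b x y w comm _ <-; rewrite !filter_cat /=; congr (_ ++ _).
case: ifP => // x_st; case: ifP => // y_st; have /commute_gen := comm.
case/pred2P: x_st => ->; case/pred2P: y_st => -> //; rewrite ?m_st //.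
by rewrite /m_ge3 m_sym -/(m_ge3 m s t) m_st.
Qed.

(** Letters [s], [t] with [m s t >= 3] never pass each other, so the subword on
    these two letters is an invariant of the commutation class. *)
Lemma alternating_not_commutation s t n a b : m_ge3 m s t ->
  ~ commutation_equiv gen (a ++ alternating s t n.+1 ++ b)
                          (a ++ alternating t s n.+1 ++ b).
Proof.
move=> m_st /(commutation_filter m_st) /eqP.
have all_alt : all (pred2 s t) (alternating s t n.+1)
             && all (pred2 s t) (alternating t s n.+1).
  by rewrite !all_map; apply/andP; split; apply/allP => k _ /=;
    case: odd; rewrite eqxx ?orbT.
case/andP: all_alt => /all_filterP alt1 /all_filterP alt2.
rewrite !filter_cat alt1 alt2 eqseq_cat // eqxx andTb eqseq_cat ?size_alternating //.
rewrite !alternatingS eqseq_cons -andbA => /andP[/eqP eq_st _].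
by move: m_st; rewrite eq_st /m_ge3 m_diag.
Qed.
End Coxeter.

(** * Linear orders on a fixed set of labelled points *)

(** A word is represented by a sequence [q] of distinct points together with a
    labelling.  Commutations and rotations permute [q] while the points, and
    relations between them, keep their meaning. *)
Section LabelledWords.
Variables (S : finType) (m : S -> S -> nat).
Hypothesis m_diag : forall s, m s s = 1.
Hypothesis m_sym : forall s t, m s t = m t s.
Variables (X : finType) (lab : X -> S).
Implicit Types (s t : S) (x y z : X) (q a b u : seq X).

Definition dep s t := (s == t) || m_ge3 m s t.

Lemma m_ge3_sym s t : m_ge3 m s t = m_ge3 m t s.
Proof. by rewrite /m_ge3 m_sym. Qed.

Lemma dep_sym s t : dep s t = dep t s.
Proof. by rewrite /dep eq_sym m_ge3_sym. Qed.

Lemma m_ge3_neq s t : m_ge3 m s t -> s != t.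
Proof. by apply: contraTneq => ->; rewrite /m_ge3 m_diag. Qed.

Definition proj q s t := [seq x <- q | lab x \in [:: s; t]].

(** The covering relation of the cylinder over [q].  For distinct labels the
    only [t] concerned is [lab y]; for equal labels [t] ranges over all labels
    that [lab x] depends on, so that no dependent point lies between. *)
Definition cyc_cover q : rel X := fun x y => dep (lab x) (lab y) &&
  [forall t, dep (lab x) t && (lab y \in [:: lab x; t]) ==>
     (next (proj q (lab x) t) x == y)].

Inductive swap_equiv : seq X -> seq X -> Prop :=
| SwapRefl q : swap_equiv q q
| SwapStep a b x y q : ~~ dep (lab x) (lab y) ->
    swap_equiv (a ++ y :: x :: b) q -> swap_equiv (a ++ x :: y :: b) q.

Lemma swap_trans q1 q2 q3 :
  swap_equiv q1 q2 -> swap_equiv q2 q3 -> swap_equiv q1 q3.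
Proof. by elim=> // a b x y q nd _ IH /IH; apply: SwapStep. Qed.

Lemma swap_sym q1 q2 : swap_equiv q1 q2 -> swap_equiv q2 q1.
Proof.
elim=> [q | a b x y q nd _ IH]; first exact: SwapRefl.
by apply: swap_trans IH _; apply: SwapStep (SwapRefl _); rewrite dep_sym.
Qed.

Lemma swap_catl a q1 q2 : swap_equiv q1 q2 -> swap_equiv (a ++ q1) (a ++ q2).
Proof.
elim=> [q | a' b x y q nd _ IH]; first exact: SwapRefl.
by rewrite catA; apply: SwapStep => //; rewrite -catA.
Qed.

Lemma swap_perm q1 q2 : swap_equiv q1 q2 -> perm_eq q1 q2.
Proof.
elim=> // a b x y q _ _; apply: perm_trans.
by rewrite perm_cat2l -[x :: _]/([:: x] ++ [:: y] ++ b) perm_catCA.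
Qed.

Lemma swap_move x a b : (forall y, y \in a -> ~~ dep (lab y) (lab x)) ->
  swap_equiv (a ++ x :: b) (x :: a ++ b).
Proof.
elim: a => [|y a IHa] nd; first exact: SwapRefl.
apply: (@swap_trans _ (y :: x :: a ++ b)).
  by apply: (@swap_catl [:: y]); apply: IHa => z z_a; rewrite nd // inE z_a orbT.
by apply: (@SwapStep [::]); [rewrite nd ?mem_head | apply: SwapRefl].
Qed.

(** Exchanged points have independent labels, so they are not both kept in a
    projection on two dependent labels. *)
Lemma swap_proj q1 q2 s t :
  dep s t -> swap_equiv q1 q2 -> proj q1 s t = proj q2 s t.
Proof.
move=> dep_st; elim=> // a b x y q nd _ <-.
rewrite /proj !filter_cat /=; congr (_ ++ _).
case: ifP => // x_st; case: ifP => // y_st; case/negP: nd.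
move: x_st y_st dep_st; rewrite !inE /dep.
by do 2![case/pred2P=> ->]; rewrite ?eqxx // eq_sym m_ge3_sym.
Qed.

Lemma proj_rot k q s t : exists j, proj (rot k q) s t = rot j (proj q s t).
Proof.
exists (size (proj (take k q) s t)).
have -> : proj q s t = proj (take k q) s t ++ proj (drop k q) s t.
  by rewrite /proj -filter_cat cat_take_drop.
by rewrite rot_size_cat /proj filter_cat.
Qed.

Lemma cyc_cover_swap q1 q2 : swap_equiv q1 q2 -> cyc_cover q1 =2 cyc_cover q2.
Proof.
move=> eq_q x y; congr (_ && _); apply: eq_forallb => t.
by case: (boolP (dep _ _ && _)) => // /andP[d _]; rewrite (swap_proj d eq_q).
Qed.

Lemma cyc_cover_rot k q : uniq q -> cyc_cover (rot k q) =2 cyc_cover q.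
Proof.
move=> uniq_q x y; congr (_ && _); apply: eq_forallb => t.
by have [j ->] := proj_rot k q (lab x) t; rewrite next_rot // filter_uniq.
Qed.

Lemma next_proj a x b s t : uniq (a ++ x :: b) -> lab x \in [:: s; t] ->
  next (proj (a ++ x :: b) s t) x = head x (proj b s t ++ proj a s t).
Proof. exact: next_filter. Qed.

(** The covering relation can be read off the linear word between [x] and a
    later point [y]: with equal labels no point there depends on [x], with
    distinct labels none carries either of the two labels. *)
Lemma cover_consecutive a x c y b :
  uniq (a ++ x :: c ++ y :: b) -> dep (lab x) (lab y) ->
  (forall z, z \in c -> dep (lab x) (lab z) ->
     lab x != lab y /\ lab z \notin [:: lab x; lab y]) ->
  cyc_cover (a ++ x :: c ++ y :: b) x y.
Proof.
move=> uniq_q dep_xy no_z; rewrite /cyc_cover dep_xy; apply/forallP => t.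
apply/implyP => /andP[dep_t y_t]; rewrite next_proj ?mem_head //.
rewrite /proj filter_cat.
suff /eqP-> : [seq z <- c | lab z \in [:: lab x; t]] == [::] by rewrite /= y_t.
rewrite -[_ == _]negbK -has_filter -all_predC; apply/allP => z z_c /=.
apply/negP => z_t; case: (no_z z z_c) => [|neq_xy].
  by move: z_t; rewrite !inE => /pred2P[]->; rewrite // /dep eqxx.
case/negP; move: y_t z_t; rewrite !inE eq_sym (negPf neq_xy) /= => /eqP-> //.
Qed.

Lemma cover_head x y q : uniq (x :: q) -> cyc_cover (x :: q) x y ->
  y != x -> exists c b, q = c ++ y :: b /\
  forall z, z \in c -> dep (lab x) (lab z) ->
     lab x != lab y /\ lab z \notin [:: lab x; lab y].
Proof.
move=> uniq_q /andP[dep_xy /forallP cov] neq_yx.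
have nextE t : dep (lab x) t -> lab y \in [:: lab x; t] ->
    head x (proj q (lab x) t) = y.
  move=> dep_t y_t; have := cov t; rewrite dep_t y_t => /eqP.
  by rewrite /= mem_head next_head.
have y_q : y \in q.
  have := nextE (lab y) dep_xy; rewrite !inE eqxx orbT => /(_ isT).
  case Dp: (proj q _ _) neq_yx => [|z p] /= neq_yx => [/eqP|<-].
    by rewrite eq_sym (negPf neq_yx).
  suff : z \in proj q (lab x) (lab y) by rewrite mem_filter => /andP[].
  by rewrite Dp mem_head.
case/splitPr: y_q uniq_q nextE => c b uniq_q nextE; exists c, b; split=> // z z_c dep_z.
have y_c : y \notin c.
  by move: uniq_q => /= /andP[_]; rewrite cat_uniq /= negb_or => /and3P[_ /andP[]].
have notin_c t : dep (lab x) t -> lab y \in [:: lab x; t] ->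
    lab z \notin [:: lab x; t].
  move=> dep_t y_t; apply: contra y_c => z_t.
  have := nextE t dep_t y_t; rewrite /proj filter_cat.
  have : z \in proj c (lab x) t by rewrite mem_filter z_t.
  case Dp: (proj c _ _) => [//|h r] _; rewrite /proj in Dp; rewrite Dp /= => <-.
  have : h \in [seq x0 <- c | lab x0 \in [:: lab x; t]] by rewrite Dp mem_head.
  by rewrite mem_filter => /andP[].
split; last by apply: notin_c; rewrite // !inE eqxx orbT.
apply/eqP => eq_xy; have := notin_c (lab z) dep_z.
by rewrite -eq_xy !inE !eqxx orbT => /(_ isT).
Qed.

(** The part of [cylindric_convex_chain] that depends on the covering relation,
    for an arbitrary relation [R]. *)
Definition convex_chain (R : rel X) s t x p :=
  [/\ path R x p && uniq (x :: p),
      map lab (x :: p) = alternating s t (size (x :: p)) &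
      forall k u,
        path R x (take k p ++ rcons u (last x p)) ->
        uniq (x :: take k p ++ rcons u (last x p)) ->
        {subset u <= x :: p}].

Lemma cover_adjacent a x y b : uniq (a ++ x :: y :: b) ->
  dep (lab x) (lab y) -> cyc_cover (a ++ x :: y :: b) x y.
Proof. by move=> uniq_q dep_xy; apply: (@cover_consecutive a x [::] y b). Qed.

Lemma gather_equal q x y : uniq q -> x \in q -> cyc_cover q x y ->
  x != y -> lab x = lab y ->
  exists k b, swap_equiv (rot k q) (x :: y :: b).
Proof.
move=> uniq_q x_q cov_xy neq_xy eq_xy.
have [k b Dk] := rot_to x_q; exists k.
have := cov_xy; rewrite -(cyc_cover_rot k) // Dk => cov.
have [||c [d [Db no_z]]] := cover_head _ cov; rewrite ?(eq_sym y) //.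
  by rewrite -Dk rot_uniq.
exists (c ++ d); rewrite Db; apply: (@swap_catl [:: x]); apply: swap_move => z z_c.
apply/negP; rewrite dep_sym -eq_xy => /(no_z z z_c)[].
by rewrite eq_xy eqxx.
Qed.

(** A stable partition: points satisfying [P] can be moved to the front as soon
    as none of them has to pass a point on which it depends. *)
Lemma swap_filter (P : pred X) q :
  pairwise (fun y z => ~~ P y && P z ==> ~~ dep (lab y) (lab z)) q ->
  swap_equiv q (filter P q ++ filter (predC P) q).
Proof.
elim: q => [_|y q IHq /= /andP[/allP nd_y /IHq eq_q]]; first exact: SwapRefl.
have eq_yq := @swap_catl [:: y] _ _ eq_q.
case: (boolP (P y)) => Py //=; apply: swap_trans eq_yq _ => /=.
apply/swap_sym/swap_move => z; rewrite mem_filter => /andP[Pz /nd_y].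
by rewrite Py Pz /= dep_sym.
Qed.

(** An alternating chain follows the successors in the cyclic word on its two
    labels. *)
Lemma next_chain q s t x p : dep s t ->
  path (cyc_cover q) x p -> map lab (x :: p) = alternating s t (size (x :: p)) ->
  fpath (next (proj q s t)) x p.
Proof.
elim: p s t x => [|y p IHp] s t x // dep_st /andP[cov_xy path_p].
rewrite map_cons [size _]/= alternatingS => lab_p.
have lab_x : lab x = s := congr1 (head s) lab_p.
have lab_yp : map lab (y :: p) = _ := congr1 behead lab_p.
have proj_sym : proj q s t = proj q t s.
  by apply: eq_filter => z; rewrite !inE orbC.
rewrite /=; apply/andP; split; last by rewrite proj_sym; apply: IHp; rewrite // dep_sym.
have lab_y : lab y = t := congr1 (head t) lab_yp.
case/andP: cov_xy => _ /forallP /(_ t).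
by rewrite lab_x lab_y dep_st !inE eqxx orbT.
Qed.

(** * Convex chains and alternating factors *)
Section Gather.
Variables (q : seq X).
Hypotheses (uniq_q : uniq q) (all_q : forall x, x \in q).
Let forward : rel X :=
  fun y z => cyc_cover q y z && (index y q < index z q).

(** The covering relations that go forward in [q] generate the heap order: a
    point that prevents [z] from covering [y] is dependent on both. *)
Lemma dep_connect y z :
  index y q < index z q -> dep (lab y) (lab z) -> connect forward y z.
Proof.
have [n] := ubnP (index z q - index y q); elim: n y z => // n IHn y z lt_n lt_yz dep_yz.
have [a [c [d Dq]]] := split_index uniq_q (all_q z) lt_yz.
pose blocks x := dep (lab y) (lab x)
  && ((lab y == lab z) || (lab x \in [:: lab y; lab z])).
case: (boolP (has blocks c)) => [/hasP[x x_c /andP[dep_yx x_z]]|/hasPn no_block].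
  case/splitPr: x_c Dq => c1 c2 Dq.
  have y_i : index y q = size a by rewrite Dq index_cat_cons // -Dq.
  have x_i : index x q = size (a ++ y :: c1).
    have Dq' : q = (a ++ y :: c1) ++ x :: c2 ++ z :: d by rewrite Dq -!catA.
    by rewrite Dq' index_cat_cons // -Dq'.
  have z_i : index z q = size (a ++ y :: c1 ++ x :: c2).
    have Dq' : q = (a ++ y :: c1 ++ x :: c2) ++ z :: d.
      by rewrite Dq -!(catA, cat_cons).
    by rewrite Dq' index_cat_cons // -Dq'.
  have lt_yx : index y q < index x q by rewrite y_i x_i size_cat /=; lia.
  have lt_xz : index x q < index z q.
    by rewrite x_i z_i !size_cat /= size_cat /=; lia.
  apply: (@connect_trans _ _ x); apply: IHn => //; try lia.
  case/predU1P: x_z => [<-|]; first by rewrite dep_sym.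
  by rewrite !inE => /pred2P[]->; rewrite // /dep eqxx.
apply: connect1; rewrite /forward lt_yz andbT Dq; apply: cover_consecutive => //.
  by rewrite -Dq.
move=> x x_c dep_yx; have := no_block x x_c; rewrite /blocks dep_yx /= negb_or.
by case/andP.
Qed.

(** Call a point [above] or [below] when forward covering relations lead to it
    from the first point of the chain, or from it to the last one.  A point that
    is both lies on a path between the ends of the chain, hence on the chain by
    convexity.  Moving first the points that are not above to the left, then the
    points that are not below to the right, isolates the chain. *)
Lemma gather_chain s t x p : m_ge3 m s t -> head x q = x ->
  convex_chain (cyc_cover q) s t x p ->
  exists a b, swap_equiv q (a ++ (x :: p) ++ b).
Proof.
move=> m_st head_q [/andP[path_p uniq_p] lab_p convex].
have [q' Dq] : exists q', q = x :: q'.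
  by move: (all_q x) head_q; case: (q) => //= y q' _ ->; exists q'.
have dep_st : dep s t by rewrite /dep m_st orbT.
have lab_x : lab x = s := congr1 (head s) lab_p.
have [r Dr] : exists r, proj q' s t = p ++ r.
  apply: (@fpath_next_prefix _ [::] x) => //=.
    have := filter_uniq (fun x => lab x \in [:: s; t]) uniq_q.
    by rewrite Dq /= lab_x mem_head.
  by have := next_chain dep_st path_p lab_p; rewrite Dq /proj /= lab_x mem_head.
have sub_p : subseq (x :: p) q.
  apply: subseq_trans (filter_subseq (fun x => lab x \in [:: s; t]) q).
  rewrite Dq /= lab_x mem_head -/(proj q' s t) Dr.
  exact: (@prefix_subseq _ (x :: p)).
have lt_p : path (fun y z => index y q < index z q) x p.
  exact: pairwise_sorted (subseq_pairwise sub_p (pairwise_index uniq_q)).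
have fwd_p : path forward x p.
  apply/(pathP x) => i lt_i; apply/andP.
  by split; [apply: (pathP x path_p) | apply: (pathP x lt_p)].
pose above z := connect forward x z; pose below z := connect forward z (last x p).
have chainE z : above z && below z = (z \in x :: p).
  apply/andP/idP => [[/connectP[p1 path1 Dz] /connectP[p2 path2 Dlast]]|z_p].
    have path12 : path forward x (p1 ++ p2) by rewrite cat_path path1 -Dz.
    have last12 : last x (p1 ++ p2) = last x p by rewrite last_cat -Dz.
    have z12 : z \in x :: p1 ++ p2.
      by rewrite Dz -cat_cons mem_cat mem_last.
    case/lastP: (p1 ++ p2) path12 last12 z12 => [_ _|u y].
      by rewrite inE => /eqP->; rewrite mem_head.
    rewrite last_rcons => path_u y_last; rewrite y_last in path_u *.
    have uniq_u : uniq (x :: rcons u (last x p)).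
      apply: (@sorted_uniq _ (fun y z => index y q < index z q)).
      - by move=> ? ? ?; apply: ltn_trans.
      - by move=> ?; rewrite ltnn.
      - by apply: sub_path path_u => ? ? /andP[].
    rewrite inE mem_rcons inE => /or3P[/eqP->|/eqP->|].
    - exact: mem_head.
    - exact: mem_last.
    - apply: (convex 0); rewrite take0 //=.
      by apply: sub_path path_u => ? ? /andP[].
  split; first exact: path_connect fwd_p _ z_p.
  rewrite /below; case/splitPl: z_p fwd_p => p1 p2 Dz; rewrite cat_path last_cat Dz.
  by case/andP=> _ path2; apply: path_connect path2 _ (mem_last _ _).
have lt_connect y z : index y q < index z q -> dep (lab y) (lab z) ->
  (above y -> above z) /\ (below z -> below y).
  move=> lt_yz /(dep_connect lt_yz) yz.
  by split=> ?; [apply: connect_trans yz | apply: connect_trans yz _].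
exists (filter (predC above) q), (filter (predC below) (filter above q)).
have above_low : swap_equiv q (filter (predC above) q ++ filter above q).
  have -> : filter above q = filter (predC (predC above)) q.
    by apply: eq_filter => z /=; rewrite negbK.
  apply: swap_filter; apply: sub_pairwise (pairwise_index uniq_q) => y z lt_yz /=.
  apply/implyP; rewrite negbK => /andP[above_y not_above_z].
  by apply: contra not_above_z => /(lt_connect _ _ lt_yz)[->].
apply: swap_trans above_low _; apply: swap_catl.
have -> : x :: p = filter below (filter above q).
  rewrite -filter_predI (eq_filter (a2 := [in x :: p])).
    by apply/subseq_uniqP.
  by move=> z /=; rewrite andbC chainE.
apply: swap_filter; apply: subseq_pairwise (filter_subseq above q) _.
apply: sub_pairwise (pairwise_index uniq_q) => y z lt_yz.
apply/implyP => /andP[not_below_y below_z].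
by apply: contra not_below_y => /(lt_connect _ _ lt_yz)[_ ->].
Qed.
End Gather.

(** If all points but the last two have a single successor and the last one has
    a single predecessor, a path without repetition between the ends has no
    choice. *)
Lemma forced_path (R : rel X) x p u :
  (forall f y1 y2 y3 g, x :: p = f ++ [:: y1, y2, y3 & g] ->
     forall w, R y1 w -> w = y2) ->
  (forall f y1 y2, x :: p = f ++ [:: y1; y2] -> forall w, R w y2 -> w = y1) ->
  0 < size p -> uniq (x :: p) ->
  path R x (rcons u (last x p)) -> uniq (x :: rcons u (last x p)) ->
  rcons u (last x p) = p.
Proof.
elim: p x u => // y [|z p] IHp x u succ pred _ uniq_p path_u uniq_u.
  case/lastP: u path_u uniq_u => // u w /=; rewrite rcons_path last_rcons.
  case/andP=> _ /(pred [::] x y erefl) ->.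
  by rewrite !(mem_rcons, inE) eqxx orbT.
case: u path_u uniq_u => [|w u] /= /andP[R_xw path_u] uniq_u.
  have y_last := succ [::] x y z p erefl _ R_xw.
  by have /and3P[_ /negP[]] := uniq_p; rewrite -[X in X \in _]y_last mem_last.
have w_y := succ [::] x y z p erefl _ R_xw; subst w; congr (y :: _).
apply: (IHp y u) => //.
- by move=> f y1 y2 y3 g Dp; apply: (succ (x :: f) y1 y2 y3 g); rewrite Dp.
- by move=> f y1 y2 Dp; apply: (pred (x :: f) y1 y2); rewrite Dp.
- by case/andP: uniq_p.
- by case/andP: uniq_u.
Qed.

(** A neighbour of [x] other than [y] cannot follow [x], because [z], which has
    the same label as [x], is met first. *)
Lemma succ_unique a x y z b w : uniq (a ++ [:: x, y, z & b]) ->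
  m_ge3 m (lab x) (lab y) -> lab z = lab x ->
  cyc_cover (a ++ [:: x, y, z & b]) x w -> w = y.
Proof.
move=> uniq_q m_xy lab_z /andP[dep_w /forallP cov].
have nextE t : dep (lab x) t -> lab w \in [:: lab x; t] ->
    head x (proj [:: y, z & b] (lab x) t ++ proj a (lab x) t) = w.
  move=> dep_t w_t; have := cov t; rewrite dep_t w_t next_proj ?mem_head //.
  by move/eqP.
case: (boolP (lab w \in [:: lab x; lab y])) => [w_xy|].
  rewrite -(nextE (lab y) _ w_xy) ?/dep ?m_xy ?orbT //.
  by rewrite /proj /= !inE eqxx orbT.
rewrite !inE negb_or => /andP[w_x w_y].
have := nextE (lab w) dep_w.
rewrite /proj /= !inE !(eq_sym (lab y)) (negPf w_y) lab_z eqxx orbT.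
rewrite (negPf (m_ge3_neq m_xy)) eqxx /= => /(_ isT) z_w.
by rewrite -z_w lab_z eqxx in w_x.
Qed.

Lemma pred_unique a x y z b w : uniq (a ++ [:: x, y, z & b]) ->
  m_ge3 m (lab x) (lab y) -> lab z = lab x ->
  cyc_cover (a ++ [:: x, y, z & b]) w z -> w = y.
Proof.
set q := a ++ _ => uniq_q m_xy lab_z /andP[dep_w /forallP cov].
have nextE t : dep (lab w) t -> lab z \in [:: lab w; t] ->
    next (proj q (lab w) t) w = z.
  by move=> dep_t z_t; have := cov t; rewrite dep_t z_t => /eqP.
have next_inj s t : injective (next (proj q s t)).
  exact: can_inj (prev_next (filter_uniq _ uniq_q)).
case: (boolP (lab w \in [:: lab x; lab y])) => [w_xy|].
  have next_y : next (proj q (lab x) (lab y)) y = z.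
    have Dq : q = (a ++ [:: x]) ++ y :: z :: b by rewrite -catA.
    rewrite Dq next_proj -?Dq ?inE ?eqxx ?orbT //.
    by rewrite /proj /= !inE lab_z eqxx.
  apply: (next_inj (lab x) (lab y)); rewrite next_y.
  move: w_xy; rewrite !inE => /pred2P[] w_lab; rewrite -w_lab.
    by apply: nextE; rewrite w_lab ?/dep ?m_xy ?orbT // lab_z mem_head.
  rewrite -[RHS](nextE (lab x)) ?w_lab ?lab_z.
  - by congr next; apply: eq_filter => i; rewrite !inE orbC.
  - by rewrite dep_sym /dep m_xy orbT.
  - by rewrite !inE eqxx orbT.
rewrite !inE negb_or => /andP[w_x w_y].
have : next (proj q (lab w) (lab x)) x = z.
  rewrite next_proj ?inE ?eqxx ?orbT // /proj /= !inE lab_z eqxx orbT.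
  by rewrite !(eq_sym (lab y)) (negPf w_y) (negPf (m_ge3_neq m_xy)).
rewrite -(nextE (lab x)) ?lab_z ?inE ?eqxx ?orbT //; last by rewrite -lab_z.
by move/next_inj => x_w; rewrite x_w eqxx in w_x.
Qed.

Lemma factor_path a x p b s t :
  uniq (a ++ (x :: p) ++ b) -> m_ge3 m s t ->
  map lab (x :: p) = alternating s t (size (x :: p)) ->
  path (cyc_cover (a ++ (x :: p) ++ b)) x p.
Proof.
elim: p a x s t => //= y p IHp a x s t uniq_q m_st lab_p.
have lab_x : lab x = s := congr1 (head s) lab_p.
have lab_yp : map lab (y :: p) = alternating t s (size (y :: p)).
  by move: lab_p; rewrite alternatingS => /(congr1 behead).
have lab_y : lab y = t := congr1 (head t) lab_yp.
apply/andP; split; first by apply: cover_adjacent; rewrite // lab_x lab_y /dep m_st orbT.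
have Dq : a ++ x :: y :: p ++ b = rcons a x ++ (y :: p) ++ b by rewrite cat_rcons.
by rewrite Dq; apply: (IHp _ _ t s); rewrite -?Dq // m_ge3_sym.
Qed.

Lemma factor_convex a x p b s t :
  uniq (a ++ (x :: p) ++ b) -> m_ge3 m s t -> 3 <= size (x :: p) ->
  map lab (x :: p) = alternating s t (size (x :: p)) ->
  convex_chain (cyc_cover (a ++ (x :: p) ++ b)) s t x p.
Proof.
set q := a ++ _ => uniq_q m_st size_p lab_p.
have uniq_p : uniq (x :: p).
  by move: uniq_q; rewrite cat_uniq cat_uniq => /and3P[_ _ /and3P[]].
have three f y1 y2 y3 g : x :: p = f ++ [:: y1, y2, y3 & g] ->
    [/\ q = (a ++ f) ++ [:: y1, y2, y3 & g ++ b], m_ge3 m (lab y1) (lab y2)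
      & lab y3 = lab y1].
  move=> Dp; have [s' [t' [m_st' lab_f]]] : exists s' t', m_ge3 m s' t' /\
      map lab [:: y1, y2, y3 & g] = alternating s' t' (size g).+3.
    rewrite -(size_map lab g) -[_.+3]/(size (map lab [:: y1, y2, y3 & g])).
    have lab_fg : alternating s t (size (x :: p))
        = map lab f ++ map lab [:: y1, y2, y3 & g] by rewrite -map_cat -Dp lab_p.
    have [lab_f|lab_f] := alternating_suffix lab_fg; first by exists s, t.
    by exists t, s; split=> //; rewrite m_ge3_sym.
  have lab1 : lab y1 = s' := congr1 (fun w => nth s' w 0) lab_f.
  have lab2 : lab y2 = t' := congr1 (fun w => nth s' w 1) lab_f.
  have lab3 : lab y3 = s' := congr1 (fun w => nth s' w 2) lab_f.
  by split; rewrite ?lab1 ?lab2 // /q Dp -!catA.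
have path_p : path (cyc_cover q) x p.
  exact: factor_path lab_p.
split=> //; first by rewrite path_p.
move=> k u; rewrite -rcons_cat => path_u uniq_u.
have := forced_path (R := cyc_cover q) (x := x) (p := p)
  (u := take k p ++ u) _ _ _ uniq_p path_u uniq_u.
move=> Dp z z_u; rewrite inE -Dp ?mem_rcons ?inE ?mem_cat ?z_u ?orbT //.
- move=> f y1 y2 y3 g Df w.
  have [Dq m_y lab_y] := three _ _ _ _ _ Df.
  by rewrite Dq; apply: succ_unique; rewrite -?Dq.
- move=> f y1 y2 Df w.
  case/lastP: f Df => [Df|f y0]; first by rewrite Df in size_p.
  rewrite cat_rcons => Df; have [Dq m_y lab_y] := three _ _ _ _ _ Df.
  by rewrite Dq; apply: pred_unique; rewrite -?Dq.
- by move: size_p; case: (p).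
Qed.

Lemma eq_convex_chain (R R' : rel X) s t x p : R =2 R' ->
  convex_chain R s t x p -> convex_chain R' s t x p.
Proof.
move=> eq_R [path_p lab_p convex]; split; rewrite -?(eq_path eq_R) //.
by move=> k u; rewrite -(eq_path eq_R); apply: convex.
Qed.

Lemma gather_convex q s t x p : uniq q -> (forall y, y \in q) -> m_ge3 m s t ->
  convex_chain (cyc_cover q) s t x p ->
  exists k a b, swap_equiv (rot k q) (a ++ (x :: p) ++ b).
Proof.
move=> uniq_q all_q m_st conv; have [k b Dk] := rot_to (all_q x); exists k.
apply: (@gather_chain _ _ _ s t) => //.
- by rewrite rot_uniq.
- by move=> y; rewrite mem_rot.
- by rewrite Dk.
- by apply: eq_convex_chain conv => y z; rewrite cyc_cover_rot.
Qed.

(** A commutation class is determined by its projections on pairs of dependent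
    labels: the first point of [q1] is preceded in [q2] only by points
    independent of it, and can be brought to the front. *)
Lemma proj_swap q1 q2 : uniq q1 -> perm_eq q1 q2 ->
  (forall s t, dep s t -> proj q1 s t = proj q2 s t) -> swap_equiv q1 q2.
Proof.
elim: q1 q2 => [|x q1 IHq] q2 uniq_q1 perm_q eq_proj.
  by rewrite perm_sym in perm_q; move/perm_nilP: perm_q => ->; apply: SwapRefl.
have x_q2 : x \in q2 by rewrite -(perm_mem perm_q) mem_head.
have uniq_q2 : uniq q2 by rewrite -(perm_uniq perm_q).
case/splitPr: x_q2 perm_q uniq_q2 eq_proj => a b perm_q uniq_q2 eq_proj.
have x_a : x \notin a.
  by move: uniq_q2; rewrite cat_uniq /= negb_or => /and3P[_ /andP[]].
have nd_a y : y \in a -> ~~ dep (lab y) (lab x).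
  move=> y_a; apply: contra x_a => /eq_proj; rewrite /proj /= filter_cat.
  rewrite !inE eqxx orbT.
  case Da: [seq z <- a | _] => [|z a'] /= [].
    have := mem_filter (fun z => lab z \in [:: lab y; lab x]) y a.
    by rewrite Da y_a !inE eqxx.
  move=> -> _; have : z \in z :: a' by rewrite mem_head.
  by rewrite -Da mem_filter => /andP[].
apply/swap_sym; apply: swap_trans (swap_move b nd_a) _.
apply: (@swap_catl [:: x]); apply/swap_sym/IHq.
- by case/andP: uniq_q1.
- by rewrite -(perm_cons x) (perm_trans perm_q) // -cat1s perm_catCA.
move=> s t dep_st; have := swap_proj dep_st (swap_move b nd_a).
rewrite -(eq_proj _ _ dep_st) /proj /=; case: ifP => // _ [].
by [].
Qed.
End LabelledWords.

(** * The cylindric transformation of a heap *)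
Section HeapCover.
Variables (S : finType) (m : S -> S -> nat).
Hypothesis m_diag : forall s, m s s = 1.
Hypothesis m_sym : forall s t, m s t = m t s.
Variable v : seq S.
Local Notation H := (heap m v).
Local Notation lab := (@label S H).
Local Notation dep := (dep m).
Implicit Types i j z : H.

Local Arguments label : simpl never.
Local Arguments prec : simpl never.

Let pos i : nat := (i : 'I_(size v)).

Lemma connect_pos i j :
  connect (@heap_edge S m v) i j -> pos i <= pos j.
Proof.
case/connectP => p path_p ->; elim: p i path_p => //= k p IHp i.
case/andP=> /andP[lt_ik _] /IHp; exact/leq_trans/ltnW.
Qed.

Lemma prec_first i j : prec i j ->
  exists2 k, pos i < pos k <= pos j & dep (lab i) (lab k).
Proof.
case/existsP=> k /andP[/andP[lt_ik dep_ik] /connect_pos le_kj].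
by exists k => //; rewrite lt_ik.
Qed.

Lemma prec_last i j : prec i j ->
  exists2 k, pos i <= pos k < pos j & dep (lab k) (lab j).
Proof.
case/existsP=> k /andP[/andP[lt_ik dep_ik] /connectP[p]].
case/lastP: p => [_ ->|p z]; first by exists i; rewrite // leqnn.
rewrite rcons_path last_rcons => /andP[path_p /andP[lt_z dep_z]] ->.
exists (last k p) => //; rewrite lt_z andbT ltnW //; apply: leq_trans lt_ik _.
by apply: connect_pos; apply/connectP; exists p.
Qed.

Lemma prec_pos i j : prec i j -> pos i < pos j.
Proof. by case/prec_first => k /andP[/leq_trans h /h]. Qed.

Lemma prec_dep i j : pos i < pos j -> dep (lab i) (lab j) -> prec i j.
Proof.
by move=> lt_ij dep_ij; apply/existsP; exists j; rewrite connect0 andbT; apply/andP.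
Qed.

(** [z] is met strictly after [i] and before [j] when going around the cylinder;
    for [i = j] this is a full turn. *)
Definition cyc_between i z j :=
  if pos i < pos j then pos i < pos z < pos j else (pos i < pos z) || (pos z < pos j).

Lemma pairwise_enum : pairwise (fun y z => pos y < pos z) (enum H).
Proof.
rewrite -(pairwise_map pos ltn) [X in pairwise _ X](val_enum_ord (size v)).
by rewrite -sorted_pairwise ?iota_ltn_sorted //; apply: ltn_trans.
Qed.

Lemma head_filter_min (P : pred H) r h r' z :
  pairwise (fun y z => pos y < pos z) r -> filter P r = h :: r' ->
  z \in r -> P z -> ~~ (pos z < pos h).
Proof.
move=> /(subseq_pairwise (filter_subseq P r)) pair_r Dr z_r Pz.
have : z \in filter P r by rewrite mem_filter Pz.
move: pair_r; rewrite Dr /= inE => /andP[/allP lt_h _] /predU1P[->|/lt_h].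
  by rewrite ltnn.
by rewrite -leqNgt => /ltnW.
Qed.

(** The successor of [i] satisfies the right-hand side, and two points that
    satisfy it coincide, as one of them would otherwise lie between [i] and the
    other. *)
Lemma next_enum (P : pred H) i j : P i -> P j ->
  (next (filter P (enum H)) i == j) = [forall z, P z ==> ~~ cyc_between i z j].
Proof.
move=> Pi Pj; set k := next _ i.
have [Pk no_z] : P k /\ forall z, P z -> ~~ cyc_between i z k.
  have all_q z : z \in enum H by rewrite mem_enum.
  have := pairwise_enum; have := enum_uniq H; rewrite /k.
  case/splitPr: (all_q i) (all_q) => a b mem_q uniq_q.
  rewrite (next_filter uniq_q) // pairwise_cat /= => /and3P[].
  rewrite allrel_consr => /andP[/allP lt_a _] pair_a /andP[/allP lt_b pair_b].
  have mem z : [|| z \in a, z == i | z \in b].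
    by have := mem_q z; rewrite mem_cat inE.
  have out (r : seq H) z : filter P r = [::] -> P z -> z \notin r.
    by move=> Dr Pz; apply/negP => z_r; have := mem_filter P z r; rewrite Dr Pz z_r.
  have in_filter (r r' : seq H) h : filter P r = h :: r' -> P h /\ h \in r.
    by move=> Dr; apply/andP; rewrite -mem_filter Dr mem_head.
  case Db: (filter P b) => [|h r] /=; last first.
    have [Ph h_b] := in_filter _ _ _ Db; split=> // z Pz.
    have lt_ih := lt_b h h_b; rewrite /cyc_between lt_ih; apply/andP=> -[lt_iz lt_zh].
    case/or3P: (mem z) => [/lt_a|/eqP eq_z|z_b].
    - by rewrite ltnNge ltnW.
    - by rewrite eq_z ltnn in lt_iz.
    - by have := head_filter_min pair_b Db z_b Pz; rewrite lt_zh.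
  have below_i z : P z -> z != i -> z \in a.
    move=> Pz neq_zi; case/or3P: (mem z) => // [eq_zi|z_b].
      by rewrite eq_zi in neq_zi.
    by have := out b z Db Pz; rewrite z_b.
  case Da: (filter P a) => [|h r] /=.
    split=> // z Pz; have [->|/(below_i z Pz) z_a] := eqVneq z i.
      by rewrite /cyc_between ltnn.
    by have := out a z Da Pz; rewrite z_a.
  have [Ph h_a] := in_filter _ _ _ Da; split=> // z Pz.
  have lt_hi := lt_a h h_a; rewrite /cyc_between ltnNge ltnW //=.
  have [->|/(below_i z Pz) z_a] := eqVneq z i; first by rewrite ltnn /= -leqNgt ltnW.
  rewrite negb_or (head_filter_min pair_a Da z_a Pz) andbT -leqNgt ltnW //.
  exact: lt_a.
apply/eqP/forallP => [<- z|no_zj]; first by apply/implyP; apply: no_z.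
have := no_z j Pj; have := no_zj k; rewrite Pk /cyc_between /= => h1 h2.
suff: pos k = pos j by move/val_inj.
move: h1 h2; move: (pos i) (pos j) (pos k) => ni nj nk.
by case: (ltnP ni nj) => ?; case: (ltnP ni nk) => ? /=; lia.
Qed.

Lemma next_proj_enum i j t : lab j \in [:: lab i; t] ->
  (next (proj lab (enum H) (lab i) t) i == j)
  = [forall z, (lab z \in [:: lab i; t]) ==> ~~ cyc_between i z j].
Proof. exact: (next_enum (P := fun z => lab z \in [:: lab i; t])) (mem_head _ _). Qed.

Lemma cyc_cover_enumP i j : reflect
  (dep (lab i) (lab j) /\ forall z, dep (lab i) (lab z) ->
     (lab i == lab j) || (lab z \in [:: lab i; lab j]) -> ~~ cyc_between i z j)
  (cyc_cover m lab (enum H) i j).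
Proof.
apply: (iffP andP) => -[dep_ij gap]; split=> //.
  move=> z dep_iz z_ij; move/forallP: gap => gap.
  have [t [dep_t j_t z_t]] : exists t,
      [/\ dep (lab i) t, lab j \in [:: lab i; t] & lab z \in [:: lab i; t]].
    case/orP: z_ij => [/eqP eq_ij|z_ij].
      by exists (lab z); rewrite -eq_ij mem_head !inE eqxx orbT.
    by exists (lab j); split=> //; rewrite !inE eqxx orbT.
  have := gap t; rewrite dep_t j_t next_proj_enum //.
  by move/forallP/(_ z); rewrite z_t.
apply/forallP => t; apply/implyP => /andP[dep_t j_t].
rewrite next_proj_enum //; apply/forallP => z; apply/implyP => z_t.
apply: gap.
  by move: z_t; rewrite !inE => /pred2P[]->; rewrite // /dep eqxx.
by move: j_t; rewrite in_cons mem_seq1 => /pred2P[]->; rewrite ?eqxx ?z_t ?orbT.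
Qed.

Lemma dep_neq s t : dep s t -> s != t -> m_ge3 m s t.
Proof. by case/predU1P => // ->; rewrite eqxx. Qed.

(** When [i] precedes [j], only a covering relation of the heap itself can hold;
    otherwise only one of the two kinds of added relations can, according to
    whether the labels are equal. *)
Lemma cyl_coverE : cyl_cover m (H := H) =2 cyc_cover m lab (enum H).
Proof.
move=> i j; apply/idP/cyc_cover_enumP.
  case/or3P.
  - case/andP=> prec_ij; have lt_ij := prec_pos prec_ij.
    rewrite /cyc_between lt_ij.
    case/orP=> /andP[].
      move=> m_ij /existsPn no_z; have dep_ij : dep (lab i) (lab j).
        by rewrite /dep m_ij orbT.
      split=> // z dep_iz; rewrite (negPf (m_ge3_neq m_diag m_ij)) /= !inE => z_ij.
      apply: contra (no_z z) => /andP[lt_iz lt_zj]; rewrite z_ij !prec_dep //.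
      by case/pred2P: z_ij => -> //; rewrite /dep eqxx.
    move=> eq_ij /existsPn no_z; split=> [|z dep_iz _]; first by rewrite /dep eq_ij.
    apply: contra (no_z z) => /andP[lt_iz lt_zj]; rewrite !prec_dep //.
    by rewrite -(eqP eq_ij) dep_sym.
  - case/existsP=> s /and4P[/andP[j_s _] /andP[i_s _]].
    move: j_s i_s; rewrite !inE => /eqP j_s /eqP i_s.
    case/andP=> _ /forallP min_j /andP[_ /forallP max_i].
    split=> [|z]; first by rewrite i_s j_s /dep eqxx.
    rewrite i_s => dep_z _; rewrite /cyc_between; case: ifP => [lt_ij|_].
      have := min_j i; rewrite inE /= prec_dep // i_s j_s /dep eqxx //.
    apply/norP; split; apply/negP => lt_z.
      by have := max_i z; rewrite inE /= prec_dep // i_s.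
    by have := min_j z; rewrite inE /= prec_dep // j_s dep_sym.
  - case/existsP=> s /existsP[t /and4P[m_st /andP[j_st /forallP min_j]]].
    case/andP=> i_st /forallP max_i neq_ji.
    have depE x y : x \in subheap H [set s; t] -> y \in subheap H [set s; t] ->
        dep (lab x) (lab y).
      rewrite !inE /dep => /pred2P[]-> /pred2P[]->; rewrite ?eqxx ?m_st ?orbT //.
      by rewrite (m_ge3_sym m_sym) m_st orbT.
    split=> [|z _]; first exact: depE.
    rewrite eq_sym (negPf neq_ji) /= => z_ij.
    have z_st : z \in subheap H [set s; t].
      by move: z_ij i_st j_st; rewrite !inE => /pred2P[]->.
    rewrite /cyc_between; case: ifP => [lt_ij|_].
      by have := min_j i; rewrite i_st prec_dep // depE.
    apply/norP; split; apply/negP => lt_z.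
      by have := max_i z; rewrite z_st prec_dep // depE.
    by have := min_j z; rewrite z_st prec_dep // depE.
case=> dep_ij gap; rewrite /cyl_cover /chain_cover.
have [lt_ij|le_ji] := ltnP (pos i) (pos j).
  rewrite prec_dep //=; have [eq_ij|neq_ij] := eqVneq (lab i) (lab j).
    apply/orP; left; apply/orP; right; apply/existsPn => z.
    apply/negP => /andP[/prec_first[k /andP[lt_ik le_kz] dep_ik] /prec_pos lt_zj].
    have := gap k dep_ik; rewrite eq_ij eqxx => /(_ isT).
    by rewrite /cyc_between lt_ij lt_ik (leq_ltn_trans le_kz).
  rewrite (dep_neq dep_ij neq_ij) /=; apply/orP; left; apply/orP; left.
  apply/existsPn => z; apply/negP => /and3P[z_ij /prec_pos lt_iz /prec_pos lt_zj].
  have dep_iz : dep (lab i) (lab z).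
    by case/pred2P: z_ij => ->; rewrite // /dep eqxx.
  have := gap z dep_iz; rewrite !inE z_ij orbT => /(_ isT).
  by rewrite /cyc_between lt_ij lt_iz lt_zj.
apply/orP; right; apply/orP.
have [eq_ij|neq_ij] := eqVneq (lab i) (lab j).
  left; apply/existsP; exists (lab i).
  have no_first z : ~~ prec z j.
    apply/negP => /prec_last[k /andP[_ lt_kj] dep_kj].
    have := gap k; rewrite eq_ij eqxx dep_sym // dep_kj => /(_ isT isT).
    by rewrite /cyc_between ltnNge le_ji lt_kj orbT.
  have no_last z : ~~ prec i z.
    apply/negP => /prec_first[k /andP[lt_ik _] dep_ik].
    have := gap k dep_ik; rewrite eq_ij eqxx => /(_ isT).
    by rewrite /cyc_between ltnNge le_ji lt_ik.
  by apply/and4P; split; rewrite /minimal_in /maximal_in !inE ?eq_ij ?eqxx;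
    apply/forall_inP.
right; apply/existsP; exists (lab i); apply/existsP; exists (lab j).
have gap' z : z \in subheap H [set lab i; lab j] -> ~~ cyc_between i z j.
  rewrite !inE => z_ij; apply: gap; last by rewrite !inE z_ij orbT.
  by case/pred2P: z_ij => ->; rewrite // /dep eqxx.
rewrite /cyc_between ltnNge le_ji /= in gap'.
apply/and4P; split=> //.
- exact: dep_neq.
- apply/andP; split; first by rewrite !inE eqxx orbT.
  apply/forall_inP => z /gap'; rewrite negb_or => /andP[_].
  by apply: contra => /prec_pos.
- apply/andP; split; first by rewrite !inE eqxx.
  apply/forall_inP => z /gap'; rewrite negb_or => /andP[+ _].
  by apply: contra => /prec_pos.
Qed.
End HeapCover.
(** * Cyclic full commutativity *)
Section Criterion.
Variables (S : finType) (m : S -> S -> nat) (W : groupType) (gen : S -> W).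
Hypothesis hW : coxeter_system m gen.
Local Notation m_diag := (m_diag hW).
Local Notation m_sym := (m_sym hW).
Variables (X : finType) (lab : X -> S).
Implicit Types (s t : S) (x y : X) (q : seq X).

(** The two conditions of the theorem, as a property of the covering relation
    alone. *)
Definition admissible (R : rel X) :=
  (forall s t x p, 3 <= m s t -> size (x :: p) = m s t ->
     ~ convex_chain lab R s t x p) /\
  (forall x y, x <> y -> R x y -> lab x <> lab y).

Lemma eq_admissible (R R' : rel X) : R =2 R' -> admissible R -> admissible R'.
Proof.
move=> eq_R [no_chain no_equal]; split=> [s t x p m_st size_p conv | x y].
  by apply: no_chain m_st size_p _; apply: eq_convex_chain conv => ? ?; rewrite eq_R.
by rewrite -eq_R; apply: no_equal.
Qed.

Lemma dep_commute s t : ~~ dep m s t -> commute (gen s) (gen t).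
Proof. by rewrite negb_or => /andP[_ nm]; apply/(commute_gen hW). Qed.

Lemma swap_commutation q1 q2 : swap_equiv m lab q1 q2 ->
  commutation_equiv gen (map lab q1) (map lab q2).
Proof.
elim=> [q | a b x y q nd _ IH]; first exact: CommRefl.
by rewrite map_cat; apply: CommStep (dep_commute nd) _; rewrite map_cat in IH.
Qed.

Lemma admissible_swap q1 q2 : swap_equiv m lab q1 q2 ->
  admissible (cyc_cover m lab q1) -> admissible (cyc_cover m lab q2).
Proof. by move/(cyc_cover_swap m_sym)/eq_admissible; apply. Qed.

(** A braid move with [m s t >= 3] would start from an alternating factor, which
    is a convex chain; those with [m s t = 2] are commutations, and the others
    do not change the word. *)
Lemma admissible_braid q w : uniq q -> admissible (cyc_cover m lab q) ->
  braid_equiv m (map lab q) w ->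
  exists2 q', swap_equiv m lab q q' & map lab q' = w.
Proof.
move=> uniq_q adm_q eq_w; move Du: (map lab q) eq_w => u eq_w.
elim: eq_w q uniq_q adm_q Du => {u w} [w | a b s t w _ IH] q uniq_q adm_q Dq.
  by exists q; first exact: SwapRefl.
have [qa [qf [qb [Dabf Da Df Db]]]] : exists qa qf qb, [/\ q = qa ++ qf ++ qb,
    map lab qa = a, map lab qf = alternating s t (m s t) & map lab qb = b].
  exists (take (size a) q), (take (m s t) (drop (size a) q)),
         (drop (m s t) (drop (size a) q)).
  rewrite !cat_take_drop map_take !map_drop map_take map_drop Dq.
  rewrite take_size_cat // drop_size_cat //.
  by rewrite take_size_cat ?drop_size_cat ?size_alternating.
case: (ltnP 2 (m s t)) => [m_gt2|].
  case: qf Df Dabf => [|x p] Df Dabf.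
    by move: m_gt2; rewrite -(size_alternating s t (m s t)) -Df.
  have size_p : size (x :: p) = m s t by rewrite -(size_map lab) Df size_alternating.
  case: (adm_q.1 s t x p m_gt2 size_p); rewrite Dabf.
  apply: (factor_convex m_diag m_sym); rewrite -?Dabf // ?size_p //.
  by rewrite /m_ge3 m_gt2 orbT.
case Dm: (m s t) Df => [|[|[|//]]] Df _.
- by apply: IH uniq_q adm_q _; rewrite Dabf !map_cat Da Db Df Dm.
- apply: IH uniq_q adm_q _; rewrite Dabf !map_cat Da Db Df Dm.
  by rewrite (m_eq1 hW Dm).
case: qf Df Dabf => [|x [|y [|z p]]] //= [lab_x lab_y] Dabf.
have nd : ~~ dep m (lab x) (lab y).
  rewrite lab_x lab_y /dep /m_ge3 Dm orbF.
  by apply/eqP => eq_st; have := m_diag s; rewrite {2}eq_st Dm.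
have swap_q : swap_equiv m lab q (qa ++ y :: x :: qb).
  by rewrite Dabf; apply: SwapStep nd (SwapRefl _ _ _).
have [|||q' eq_q' Dq'] := IH (qa ++ y :: x :: qb).
- by rewrite -(perm_uniq (swap_perm swap_q)).
- exact: admissible_swap swap_q adm_q.
- by rewrite map_cat /= Da Db lab_x lab_y Dm.
by exists q' => //; apply: swap_trans eq_q'.
Qed.

Lemma admissible_reduced q : uniq q -> admissible (cyc_cover m lab q) ->
  reduced gen (map lab q).
Proof.
move=> uniq_q adm_q; apply: boolp.contrapT => /(tits_deletion hW)[a [s [b eq_ss]]].
have [q' eq_q Dq'] := admissible_braid uniq_q adm_q eq_ss.
have [qa [x [y [qb [Dq lab_x lab_y]]]]] : exists qa x y qb,
    [/\ q' = qa ++ x :: y :: qb, lab x = s & lab y = s].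
  have Dd : map lab (drop (size a) q') = [:: s, s & b].
    by rewrite map_drop Dq' drop_size_cat.
  case Dd': (drop (size a) q') Dd => [|x [|y qb]] //= [lab_x lab_y _].
  by exists (take (size a) q'), x, y, qb; rewrite -Dd' cat_take_drop.
have uniq_q' : uniq q' by rewrite -(perm_uniq (swap_perm eq_q)).
have [_ no_equal] := admissible_swap eq_q adm_q.
apply: (no_equal x y); last by rewrite lab_x.
  move=> eq_xy; move: uniq_q'.
  by rewrite Dq eq_xy cat_uniq /= mem_head andbF /= !andbF.
rewrite Dq; apply: cover_adjacent; first by rewrite -Dq.
by rewrite lab_x lab_y /dep eqxx.
Qed.

Lemma admissible_expression q w : uniq q -> admissible (cyc_cover m lab q) ->
  reduced_expression_of gen (word_eval gen (map lab q)) w ->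
  exists2 q', swap_equiv m lab q q' & map lab q' = w.
Proof.
move=> uniq_q adm_q [eval_w red_w]; apply: admissible_braid => //.
by apply: (matsumoto hW) => //; apply: admissible_reduced.
Qed.

Lemma admissible_fc q : uniq q -> admissible (cyc_cover m lab q) ->
  fully_commutative gen (word_eval gen (map lab q)).
Proof.
move=> uniq_q adm_q u w /(admissible_expression uniq_q adm_q)[qu eq_u <-].
case/(admissible_expression uniq_q adm_q)=> qw eq_w <-.
by apply/swap_commutation/(swap_trans _ eq_w)/(swap_sym m_sym).
Qed.

Lemma admissible_cfc q : uniq q -> admissible (cyc_cover m lab q) ->
  cyclically_fully_commutative gen (word_eval gen (map lab q)).
Proof.
move=> uniq_q adm_q w /(admissible_expression uniq_q adm_q)[q' eq_q' <-] k.
have uniq_q' : uniq q' by rewrite -(perm_uniq (swap_perm eq_q')).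
have uniq_r : uniq (rot k q') by rewrite rot_uniq.
have adm_r : admissible (cyc_cover m lab (rot k q')).
  apply: eq_admissible (admissible_swap eq_q' adm_q) => x y.
  by rewrite cyc_cover_rot.
rewrite -map_rot; exists (word_eval gen (map lab (rot k q'))).
by split; [apply: admissible_fc | split=> //; apply: admissible_reduced].
Qed.

(** A violation of either condition shows up in some word commutation
    equivalent to a rotation of the given word: a factor [ss] contradicts
    reducedness, and replacing a long alternating factor by the other side of
    the braid relation contradicts full commutativity. *)
Lemma cfc_admissible q : uniq q -> (forall x, x \in q) ->
  reduced gen (map lab q) ->
  cyclically_fully_commutative gen (word_eval gen (map lab q)) ->
  admissible (cyc_cover m lab q).
Proof.
move=> uniq_q all_q red_q cfc_q.
have red_q' k q' : swap_equiv m lab (rot k q) q' ->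
    exists2 y, fully_commutative gen y & reduced_expression_of gen y (map lab q').
  move=> /swap_commutation eq_q'.
  have [y [fc_y [eval_y red_y]]] := cfc_q _ (conj erefl red_q) k.
  rewrite -map_rot in eval_y red_y; exists y => //; split.
    by rewrite /expression_of -(commutation_eval eq_q').
  by apply: reduced_eval red_y (commutation_eval eq_q') _;
    rewrite (commutation_size eq_q').
split=> [s t x p m_gt2 size_p conv | x y /eqP neq_xy cov_xy eq_xy].
  have m_st : m_ge3 m s t by rewrite /m_ge3 m_gt2 orbT.
  have [k [a [b eq_q]]] := gather_convex m_sym uniq_q all_q m_st conv.
  have [y fc_y] := red_q' _ _ eq_q.
  have [_ lab_p _] := conv; rewrite 2!map_cat lab_p size_p => red_y.
  have [n Dn] : exists n, m s t = n.+1 by exists (m s t).-1; rewrite prednK // ltnW // ltnW.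
  apply: (@alternating_not_commutation _ _ _ _ hW s t n (map lab a) (map lab b) m_st).
  rewrite -Dn; apply: fc_y => //; case: red_y => eval_y red_y.
  have eval_braid' : word_eval gen (map lab a ++ alternating s t (m s t) ++ map lab b)
      = word_eval gen (map lab a ++ alternating t s (m s t) ++ map lab b).
    by rewrite !eval_cat (eval_braid hW).
  split; first by rewrite /expression_of -eval_braid'.
  by apply: reduced_eval red_y eval_braid' _; rewrite !size_cat !size_alternating.
have [k [b eq_q]] := gather_equal m_sym uniq_q (all_q x) cov_xy neq_xy eq_xy.
have [z _ [_ red_z]] := red_q' _ _ eq_q.
have := red_z (map lab b); rewrite /= !eval_cons eq_xy (genMK hW) => /(_ erefl).
by rewrite ltnNge leqnSn.
Qed.
End Criterion.

(** The isomorphism transports the order of the points of the second heap to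
    another linear extension of the first heap; dependent points being
    comparable, both linear extensions have the same projections. *)
Lemma heap_iso_commutation (S : finType) (m : S -> S -> nat) (v w : seq S) :
  (forall s, m s s = 1) -> (forall s t, m s t = m t s) ->
  heap_iso (heap m v) (heap m w) ->
  exists2 q, swap_equiv m (@label S (heap m v)) (enum (heap m v)) q
           & map (@label S (heap m v)) q = w.
Proof.
move=> m_diag m_sym [f [[g fK gK] lab_f prec_f]].
exists (map g (enum (heap m w))).
  apply: (proj_swap m_sym); first exact: enum_uniq.
    apply: uniq_perm; rewrite ?enum_uniq ?(map_inj_uniq (can_inj gK)) ?enum_uniq //.
    move=> i; rewrite mem_enum inE; apply/esym/mapP; exists (f i); rewrite ?mem_enum //.
  move=> s t dep_st.
  pose lt_pos (i j : heap m v) := (i : 'I_(size v)) < (j : 'I_(size v)).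
  apply: (@irr_sorted_eq _ lt_pos).
  - by move=> ? ? ?; apply: ltn_trans.
  - by move=> ?; apply: ltnn.
  - apply: pairwise_sorted; apply: subseq_pairwise (filter_subseq _ _) _.
    exact: pairwise_enum.
  - apply: pairwise_sorted.
    have: pairwise (fun y z => dep m (label y) (label z) ==> lt_pos y z)
                   (map g (enum (heap m w))).
      rewrite pairwise_map; apply: sub_pairwise (pairwise_enum m w) => i j lt_ij.
      apply/implyP => dep_gij; apply: prec_pos; rewrite -prec_f !gK.
      by apply: prec_dep lt_ij _; rewrite -[i]gK -[j]gK !lab_f.
    move/(subseq_pairwise (filter_subseq (fun i => label i \in [:: s; t]) _)).
    apply: sub_in_pairwise (filter_all _ _) => i j i_st j_st.
    have /pred2P lab_i : pred2 s t (label i) by have := i_st; rewrite unfold_in !inE.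
    have /pred2P lab_j : pred2 s t (label j) by have := j_st; rewrite unfold_in !inE.
    move/implyP; apply; case: lab_i => ->; case: lab_j => ->;
      by rewrite // ?[dep _ t s](dep_sym m_sym) // /dep eqxx.
  - move=> i; rewrite [LHS]mem_filter [RHS]mem_filter mem_enum; congr (_ && _).
    by apply/esym/mapP; exists (f i); rewrite ?mem_enum.
rewrite -map_comp; transitivity (map (@label S (heap m w)) (enum (heap m w))).
  by apply: eq_map => j; rewrite [LHS]/comp -lab_f gK.
exact: map_tnth_enum.
Qed.

Theorem theorem1p11 (S : finType) (m : S -> S -> nat) (W : groupType)
    (gen : S -> W) (hW : coxeter_system m gen) (v : seq S) :
  (exists (x : W) (w : seq S),
      cyclically_fully_commutative gen x
      /\ reduced_expression_of gen x w
      /\ heap_iso (heap m v) (heap m w))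
  <->
  ~ (exists (s t : S) (i1 : heap m v) (p : seq (heap m v)),
        3 <= m s t /\ size (i1 :: p) = m s t
        /\ cylindric_convex_chain m s t i1 p)
  /\ ~ (exists i j : heap m v,
          i <> j /\ cyl_cover m i j /\ label i = label j).
Proof.
pose lab := @label S (heap m v).
have lab_v : map lab (enum (heap m v)) = v by apply: map_tnth_enum.
have uniq_v : uniq (enum (heap m v)) := enum_uniq _.
have all_v i : i \in enum (heap m v) by rewrite mem_enum.
have coverE := cyl_coverE (m_diag hW) (m_sym hW) (v := v).
transitivity (admissible m lab (cyc_cover m lab (enum (heap m v)))).
  split=> [[x [w [cfc_x [[eval_w red_w] iso]]]] | adm].
    have [q eq_q Dq] := heap_iso_commutation (m_diag hW) (m_sym hW) iso.
    have := swap_commutation hW eq_q; rewrite -/lab lab_v Dq => comm.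
    apply: (cfc_admissible hW) => //; rewrite lab_v.
      apply: reduced_eval red_w (esym (commutation_eval comm)) _.
      by rewrite (commutation_size comm).
    by rewrite (commutation_eval comm) eval_w.
  have := admissible_reduced hW uniq_v adm; have := admissible_cfc hW uniq_v adm.
  rewrite lab_v => cfc_v red_v; exists (word_eval gen v), v; split=> //.
  by split=> //; exists id; split=> //; exists id.
split=> [[no_chain no_equal] | [no_chain no_equal]]; split.
- case=> s [t [x [p [m_gt2 [size_p [_ _ path_p lab_p convex]]]]]].
  apply: no_chain m_gt2 size_p _; apply: (eq_convex_chain coverE).
  by split.
- by case=> i [j [neq_ij [cov /= eq_ij]]]; apply: no_equal neq_ij _ eq_ij; rewrite -coverE.
- move=> s t x p m_gt2 size_p conv; apply: no_chain; exists s, t, x, p; do 2!split=> //.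
  have [path_p lab_p convex] : convex_chain lab (@cyl_cover S m (heap m v)) s t x p.
    by apply: eq_convex_chain conv => ? ?; rewrite coverE.
  by split=> //; [rewrite /m_ge3 m_gt2 orbT | rewrite size_p].
- by move=> i j neq_ij cov eq_ij; apply: no_equal; exists i, j; rewrite coverE.
Qed.
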